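(* Let $\alpha\in\mathbb R$ and let $\lambda\in\operatorname{Dens}_+(M)$ be a fixed background density. The Levi-Civita connection of the restriction of the $\alpha$-Fisher--Rao metric $G^\alpha$ to $\operatorname{Prob}(M)$ is given by $$\tilde\nabla_a b=Db.a-\frac{\alpha+1}{2}\left(\frac{a}{\mu}b-\frac{\int_M\frac{a}{\mu}\frac{b}{\mu}\,\mu}{\int_M\left(\frac{\mu}{\lambda}\right)^{\alpha+1}\lambda}\left(\frac{\mu}{\lambda}\right)^{\alpha+1}\lambda\right),$$ and it coincides with the Amari--Čencov $\alpha$-connection $\overline\nabla^{(\alpha)}$ on $\operatorname{Prob}(M)$ if and only if $\alpha\in\{0,-1\}$.
   Context: $M$ is a closed, oriented, $n$-dimensional smooth manifold, $n\ge1$. $\operatorname{Dens}_+(M)=\{\mu\in\Omega^n(M):\mu>0\}$ is the Fr\'echet manifold of smooth positive densities, and $\operatorname{Prob}(M)=\{\mu\in\operatorname{Dens}_+(M):\int_M\mu=1\}$, with $T_\mu\operatorname{Prob}(M)=\{a\in\Omega^n(M):\int_M a=0\}$. For $a\in\Omega^n(M)$, $\frac{a}{\mu}\in C^\infty(M)$ is the Radon--Nikodym derivative, and $Db.a|_\mu=D_\mu b(a_\mu)$ is the directional derivative of a vector field $b$ in the direction $a_\mu$. The $\alpha$-Fisher--Rao metric is $G^\alpha_\mu(a,b)=\int_M\left(\frac{\mu}{\lambda}\right)^{-\alpha-1}\frac{a}{\lambda}\frac{b}{\lambda}\,\lambda$. The Amari--Čencov $\alpha$-connection on $\operatorname{Prob}(M)$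 is $$\overline\nabla^{(\alpha)}_a b=Db.a-\frac{1+\alpha}{2}\left(\frac{a}{\mu}b-\left(\int_M\frac{a}{\mu}\frac{b}{\mu}\,\mu\right)\mu\right).$$ The Levi-Civita connection of a (weak) Riemannian metric is the torsion-free affine connection compatible with it. *)

(* Defs.v *)
From HB Require Import structures.
From mathcomp Require Import all_boot all_order all_algebra.
From mathcomp Require Import all_classical all_reals all_analysis.

Set Implicit Arguments.
Unset Strict Implicit.
Unset Printing Implicit Defensive.

Import Order.TTheory GRing.Theory Num.Theory.
Import numFieldNormedType.Exports.

Local Open Scope classical_set_scope.
Local Open Scope ring_scope.

Section calculus.
Context {R : realType}.

Fixpoint iter_partial {n : nat} (s : seq 'I_n) (f : 'rV[R]_n -> R) :
    'rV[R]_n -> R :=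
  match s with
  | [::] => f
  | j :: s' => fun x => 'D_(delta_mx ord0 j) (iter_partial s' f) x
  end.

(* C^oo on A; only used for open A, so that the behaviour of f outside A is
   irrelevant. *)
Definition smooth_on {n : nat} (A : set 'rV[R]_n) (f : 'rV[R]_n -> R) : Prop :=
  forall (s : seq 'I_n) (x : 'rV[R]_n), A x ->
    {for x, continuous (iter_partial s f)} /\
    forall j : 'I_n, derivable (iter_partial s f) x (delta_mx ord0 j).

(* Integral over R^n as an iterated Lebesgue integral.  It is only applied to
   continuous compactly supported functions, for which it is the Lebesgue
   integral on R^n by Fubini. *)
Fixpoint integral_rV (n : nat) : ('rV[R]_n -> R) -> R :=
  match n with
  | 0%N => fun f => f 0
  | n'.+1 => fun f =>
      Rintegral lebesgue_measure [set: R]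
        (fun t : R => integral_rV (fun x : 'rV[R]_n' =>
           f (row_mx (t%:M : 'rV[R]_1) x : 'rV[R]_(n'.+1))))
  end.

End calculus.

(* An oriented smooth atlas.  Charts and their inverses are total functions,
   meaningful only on chart_dom i and on its image respectively. *)
Record oriented_atlas (R : realType) (n : nat) (M : topologicalType) := {
  chart_index : Type;
  chart_dom : chart_index -> set M;
  chart : chart_index -> M -> 'rV[R]_n;
  chart_inv : chart_index -> 'rV[R]_n -> M;
  chart_dom_open : forall i, open (chart_dom i);
  chart_img_open : forall i, open (chart i @` chart_dom i);
  chart_cover : forall p, exists i, chart_dom i p;
  chartK : forall i p, chart_dom i p -> chart_inv i (chart i p) = p;
  chart_continuous :
    forall i p, chart_dom i p -> {for p, continuous (chart i)};
  chart_inv_continuous :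
    forall i p, chart_dom i p -> {for chart i p, continuous (chart_inv i)};
  transition_smooth : forall i j (c : 'I_n),
    smooth_on (chart i @` (chart_dom i `&` chart_dom j))
              (fun x => chart j (chart_inv i x) ord0 c);
  transition_oriented : forall i j p, chart_dom i p -> chart_dom j p ->
    0 < \det (jacobian (chart j \o chart_inv i) (chart i p))
}.

Section manifold.
Context {R : realType} {n : nat} {M : topologicalType}.
Variable X : oriented_atlas R n M.

Definition chart_img (i : chart_index X) : set 'rV[R]_n :=
  chart i @` chart_dom i.

Definition chart_at (p : M) : chart_index X := sval (cid (chart_cover X p)).

Definition smooth_function (f : M -> R) : Prop :=
  forall i, smooth_on (chart_img i) (f \o @chart_inv _ _ _ X i).

(* A top-degree form a is given by its coefficients: on chart_dom i,
   a = a i dx^1 /\ ... /\ dx^n in the coordinates of chart i. *)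
Definition top_form : Type := chart_index X -> M -> R.

(* Coefficients are set to 0 off the chart domains, so that equal forms are
   equal functions. *)
Definition is_top_form (a : top_form) : Prop :=
  [/\ forall i p, ~ chart_dom i p -> a i p = 0,
      forall i, smooth_on (chart_img i) (a i \o @chart_inv _ _ _ X i) &
      forall i j p, chart_dom i p -> chart_dom j p ->
        a i p = a j p *
          \det (jacobian (@chart _ _ _ X j \o @chart_inv _ _ _ X i) (chart i p))].

Definition Dens (mu : top_form) : Prop :=
  is_top_form mu /\ forall i p, chart_dom i p -> 0 < mu i p.

Definition fscale (f : M -> R) (a : top_form) : top_form :=
  fun i p => f p * a i p.

Definition cscale (t : R) (a : top_form) : top_form := fscale (cst t) a.

(* Radon-Nikodym derivative a / mu of forms, for mu in Dens; it does not depend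
   on the chart used at p. *)
Definition rn (a mu : top_form) : M -> R :=
  fun p => a (chart_at p) p / mu (chart_at p) p.

Record partition_of_unity := {
  pou_size : nat;
  pou_chart : 'I_pou_size -> chart_index X;
  pou_fun : 'I_pou_size -> M -> R;
  pou_smooth : forall k, smooth_function (pou_fun k);
  pou_ge0 : forall k p, 0 <= pou_fun k p;
  pou_support : forall k,
    closure [set p | pou_fun k p != 0] `<=` chart_dom (pou_chart k);
  pou_sum : forall p, \sum_(k < pou_size) pou_fun k p = 1
}.

(* Smooth families of forms with parameter in an open W of R^k: the
   coefficients are jointly smooth in the parameter and the coordinates.  These
   are the smooth maps from W to the Frechet space of forms. *)
Definition smooth_family {k : nat} (W : set 'rV[R]_k)
    (c : 'rV[R]_k -> top_form) : Prop :=
  forall i, smooth_on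
    [set z : 'rV[R]_(k + n) | W (lsubmx z) /\ chart_img i (rsubmx z)]
    (fun z => c (lsubmx z) i (chart_inv i (rsubmx z))).

(* Differentiation at mu in the direction a mu, for a form-valued b and for a
   real-valued F. *)
Definition dirD (a b : top_form -> top_form) (mu : top_form) : top_form :=
  fun i p => derive1 (fun t : R => b (mu + cscale t (a mu)) i p) 0.

Definition dirD_scalar (a : top_form -> top_form) (F : top_form -> R)
    (mu : top_form) : R :=
  derive1 (fun t : R => F (mu + cscale t (a mu))) 0.

Section densities.
(* The partition of unity through which integrals over M are defined; their
   value on forms does not depend on it. *)
Variable P : partition_of_unity.

Definition integral_form (a : top_form) : R :=
  \sum_(k < pou_size P) integral_rV (fun x =>
    if x \in chart_img (pou_chart k)
    then fscale (pou_fun k) a (pou_chart k) (chart_inv (pou_chart k) x)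
    else 0).

Definition Prob (mu : top_form) : Prop := Dens mu /\ integral_form mu = 1.

(* The tangent space of Prob, which is the same at every point. *)
Definition TProb (a : top_form) : Prop := is_top_form a /\ integral_form a = 0.

(* Smooth maps out of Prob are those taking smooth finite-dimensional families
   in Prob to smooth families (convenient calculus; by Boman's theorem it is
   enough to test curves). *)
Definition smooth_scalar (F : top_form -> R) : Prop :=
  forall (k : nat) (W : set 'rV[R]_k) (c : 'rV[R]_k -> top_form),
    open W -> (forall w, W w -> Prob (c w)) -> smooth_family W c ->
    smooth_on W (F \o c).

(* Vector fields are total functions; only their values on Prob matter. *)
Definition vector_field (b : top_form -> top_form) : Prop :=
  (forall mu, Prob mu -> TProb (b mu)) /\
  forall (k : nat) (W : set 'rV[R]_k) (c : 'rV[R]_k -> top_form),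
    open W -> (forall w, W w -> Prob (c w)) -> smooth_family W c ->
    smooth_family W (b \o c).

Definition eq_on_Prob (b b' : top_form -> top_form) : Prop :=
  forall mu, Prob mu -> b mu = b' mu.

Definition vscale (F : top_form -> R) (a : top_form -> top_form) :
    top_form -> top_form :=
  fun mu => cscale (F mu) (a mu).

Record affine_connection
    (nabla : (top_form -> top_form) -> (top_form -> top_form) ->
             top_form -> top_form) : Prop := {
  conn_vector_field : forall a b, vector_field a -> vector_field b ->
    vector_field (nabla a b);
  (* nabla only depends on the values of its arguments on Prob *)
  conn_ext : forall a a' b b',
    vector_field a -> vector_field a' -> vector_field b -> vector_field b' ->
    eq_on_Prob a a' -> eq_on_Prob b b' ->
    eq_on_Prob (nabla a b) (nabla a' b');
  conn_linear_l : forall F a a' b, smooth_scalar F ->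
    vector_field a -> vector_field a' -> vector_field b ->
    eq_on_Prob (nabla (vscale F a + a') b)
               (vscale F (nabla a b) + nabla a' b);
  conn_add_r : forall a b b',
    vector_field a -> vector_field b -> vector_field b' ->
    eq_on_Prob (nabla a (b + b')) (nabla a b + nabla a b');
  conn_leibniz : forall F a b, smooth_scalar F ->
    vector_field a -> vector_field b ->
    eq_on_Prob (nabla a (vscale F b))
               (vscale (dirD_scalar a F) b + vscale F (nabla a b))
}.

(* Prob is open in an affine subspace of the space of forms, so the Lie bracket
   [a, b] of vector fields is Db.a - Da.b. *)
Definition torsion_free
    (nabla : (top_form -> top_form) -> (top_form -> top_form) ->
             top_form -> top_form) : Prop :=
  forall a b, vector_field a -> vector_field b ->
    eq_on_Prob (nabla a b - nabla b a) (dirD a b - dirD b a).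

Definition metric_compatible (G : top_form -> top_form -> top_form -> R)
    (nabla : (top_form -> top_form) -> (top_form -> top_form) ->
             top_form -> top_form) : Prop :=
  forall a b c, vector_field a -> vector_field b -> vector_field c ->
  forall mu, Prob mu ->
    dirD_scalar a (fun nu => G nu (b nu) (c nu)) mu =
    G mu (nabla a b mu) (c mu) + G mu (b mu) (nabla a c mu).

Definition levi_civita (G : top_form -> top_form -> top_form -> R)
    (nabla : (top_form -> top_form) -> (top_form -> top_form) ->
             top_form -> top_form) : Prop :=
  [/\ affine_connection nabla, torsion_free nabla & metric_compatible G nabla].

Definition fisher_rao (alpha : R) (lambda mu a b : top_form) : R :=
  integral_form (fscale
    (fun p => rn mu lambda p `^ (- alpha - 1) * rn a lambda p * rn b lambda p)
    lambda).

(* int_M (a / mu) (b / mu) mu *)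
Definition fisher_rao_pairing (mu a b : top_form) : R :=
  integral_form (fscale (fun p => rn a mu p * rn b mu p) mu).

(* (mu / lambda)^(alpha + 1) lambda *)
Definition power_form (alpha : R) (lambda mu : top_form) : top_form :=
  fscale (fun p => rn mu lambda p `^ (alpha + 1)) lambda.

Definition nabla_tilde (alpha : R) (lambda : top_form)
    (a b : top_form -> top_form) (mu : top_form) : top_form :=
  dirD a b mu -
  cscale ((alpha + 1) / 2)
    (fscale (rn (a mu) mu) (b mu) -
     cscale (fisher_rao_pairing mu (a mu) (b mu) /
             integral_form (power_form alpha lambda mu))
       (power_form alpha lambda mu)).

Definition amari_cencov (alpha : R) (a b : top_form -> top_form)
    (mu : top_form) : top_form :=
  dirD a b mu -
  cscale ((1 + alpha) / 2)
    (fscale (rn (a mu) mu) (b mu) -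
     cscale (fisher_rao_pairing mu (a mu) (b mu)) mu).

End densities.
End manifold.

(* Main.v *)
Require Import Defs.
From HB Require Import structures.
From mathcomp Require Import all_boot all_order all_algebra.
From mathcomp Require Import all_classical all_reals all_analysis.
From mathcomp Require Import ring lra.
(* The scaling [cscale] of forms must not be hidden by the one of charges. *)
Import Defs.

(** The theorem holds because of a cancellation.  Dividing by [lambda] identifies
    top forms with smooth functions on [M]: a density is a positive function
    [m], and [G mu a b] is the integral of [m^(-alpha-1) A B] against [lambda],
    with [A], [B] the functions of [a], [b].  Differentiate this along [mu + t a],
    for vector fields [b] and [c].  The weight contributes
    [(-alpha-1) m^(-alpha-2) A B C], and the two terms [-(alpha+1)/2 (a/mu) b] and
    [-(alpha+1)/2 (a/mu) c] of the connection account for one half of it each.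
    What is left in the connection is a multiple of [m^(alpha+1)], chosen so that
    the result has integral zero.  It does not disturb the compatibility with the
    metric, since [m^(-alpha-1) m^(alpha+1) = 1] and tangent vectors have integral
    zero: this is [metric_compatible_nabla_tilde].  The absence of torsion is the
    symmetry of the correction terms in [a] and [b].

    Two Levi-Civita connections differ by [S a b], symmetric in [a], [b], such
    that [G (S a b) c] changes sign when [b] and [c] are exchanged.  Such a
    trilinear form vanishes, and [G] is definite, so [S = 0]
    ([levi_civita_unique]).

    The two connections of the theorem differ by the factor
    [(alpha+1)/2 * <a, b>] times [m^(alpha+1) / int m^(alpha+1) - m].  If it
    vanishes for some [a = b <> 0], then [alpha = -1] or [m^alpha] is constant,
    and for [alpha <> 0] this excludes every non-constant [m]
    ([nabla_tilde_eq_amari_cencov_alpha]).  A non-constant smooth function exists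
    on [M]: either some function of the partition of unity is not constant, or one
    chart covers [M] and its coordinates do the job.

    Most of the work is analysis.  Smoothness is tested on finite-dimensional
    families, so the derivative of a vector field [b] in the direction [a] has to
    be recognised as a smooth family.  For a family [c] over [W], the densities
    [c w + t a (c w)] form a family with one more parameter [t]; it stays in [Prob]
    on an open set around [t = 0], because [M] is compact; and the directional
    derivative is the partial derivative in [t], at [t = 0], of [b] along this
    larger family ([extend], [dirDE]).  Integrals over [M] of smooth families are
    differentiated under the integral sign ([is_derive_integral_against]), by the
    mean value theorem and uniformity over the compact [M]. *)

Import Order.TTheory GRing.Theory Num.Theory.
Import numFieldNormedType.Exports.

Set Implicit Arguments.
Unset Strict Implicit.
Unset Printing Implicit Defensive.

Local Open Scope classical_set_scope.
Local Open Scope ring_scope.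

(** * Smooth functions on open sets of R^n *)

Section smooth_functions.
Context {R : realType}.

Definition partially_derivable {n} (A : set 'rV[R]_n) (f : 'rV[R]_n -> R) :=
  forall x, A x -> {for x, continuous f} /\
    forall j, derivable f x (delta_mx ord0 j).

Lemma iter_partial_rcons {n} (s : seq 'I_n) j (f : 'rV[R]_n -> R) :
  iter_partial (rcons s j) f =
  iter_partial s (fun x => 'D_(delta_mx ord0 j) f x).
Proof. by elim: s => //= i s ->. Qed.

Lemma near_eq_continuous {T : topologicalType} (f g : T -> R) x :
  (\forall y \near x, f y = g y) -> {for x, continuous f} ->
  {for x, continuous g}.
Proof.
move=> fg cf; rewrite /prop_for /continuous_at -(nbhs_singleton fg).
by apply: cvg_trans cf; exact: near_eq_cvg.
Qed.

(** Coinduction for smoothness: a class of functions with continuous members that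
    have partial derivatives, and that is closed under partial derivatives up to
    equality on [A], consists of smooth functions.  Every closure property below
    is obtained by choosing [C]. *)
Lemma smooth_on_coind {n} (A : set 'rV[R]_n) (C : ('rV[R]_n -> R) -> Prop) :
  open A ->
  (forall f, C f -> partially_derivable A f /\
     forall j, exists2 g, C g &
       forall x, A x -> 'D_(delta_mx ord0 j) f x = g x) ->
  forall f, C f -> smooth_on A f.
Proof.
move=> oA HC f Cf.
have nA x : A x -> \forall y \near x, A y by move=> Ax; exact: open_nbhs_nbhs.
suff H s : forall f g, C g -> (forall x, A x -> f x = g x) ->
    partially_derivable A (iter_partial s f) by move=> s; exact: (H s f f).
elim/last_ind: s => [|s j IH] {Cf}f g Cg fg.
  move=> x Ax; have [/(_ x Ax)[cg dg] _] := HC _ Cg.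
  have ngf : \forall y \near x, g y = f y.
    by near=> y; apply/esym/fg; near: y; exact: nA.
  split; first exact: near_eq_continuous cg.
  by move=> i; apply: near_eq_derivable (dg i).
rewrite iter_partial_rcons.
have [_ /(_ j)[g' Cg' gg']] := HC _ Cg.
(* The innermost derivative is replaced by a member of the class. *)
apply: (IH _ g' Cg') => x Ax; rewrite -gg'//; apply: near_eq_derive.
by near=> y; apply/fg; near: y; exact: nA.
Unshelve. all: by end_near. Qed.

Lemma smooth_on_partially_derivable {n} (A : set 'rV[R]_n) f :
  smooth_on A f -> partially_derivable A f.
Proof. by move=> /(_ [::]). Qed.

Lemma smooth_on_partial {n} (A : set 'rV[R]_n) f j :
  smooth_on A f -> smooth_on A (fun x => 'D_(delta_mx ord0 j) f x).
Proof. by move=> Af s; rewrite -iter_partial_rcons; exact: Af. Qed.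

Lemma smooth_on_ext {n} (A : set 'rV[R]_n) f g : open A ->
  (forall x, A x -> f x = g x) -> smooth_on A f -> smooth_on A g.
Proof.
move=> oA fg Af.
apply: (@smooth_on_coind _ _
  (fun h => exists2 f, smooth_on A f & forall x, A x -> f x = h x)) => //;
  last by exists f.
move=> {f g fg Af} h [f sf fh].
have nfh x : A x -> \forall y \near x, f y = h y.
  by move=> Ax; near=> y; apply/fh; near: y; exact: open_nbhs_nbhs.
split=> [x Ax|j].
  have [cf df] := smooth_on_partially_derivable sf Ax; split.
    by apply: near_eq_continuous cf; exact: nfh.
  by move=> i; apply: near_eq_derivable (df i); exact: nfh.
exists (fun x => 'D_(delta_mx ord0 j) f x).
  exists (fun x => 'D_(delta_mx ord0 j) f x); last by [].
  exact: smooth_on_partial.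
by move=> x Ax; apply/esym/near_eq_derive; exact: nfh.
Unshelve. all: by end_near. Qed.

Lemma smooth_on_sub {n} (A B : set 'rV[R]_n) f :
  A `<=` B -> smooth_on B f -> smooth_on A f.
Proof. by move=> AB Bf s x /AB; exact: Bf. Qed.

Lemma smooth_on_cst {n} (A : set 'rV[R]_n) c : open A -> smooth_on A (cst c).
Proof.
move=> oA; apply: (@smooth_on_coind _ _ (fun f => exists c, f = cst c)) => //;
  last by exists c.
move=> _ [{}c ->]; split=> [x Ax|j].
  by split; [exact: cst_continuous|move=> j; exact: derivable_cst].
by exists (cst 0); [exists 0|move=> x Ax; exact: derive_cst].
Qed.

(** The difference quotients of [f \o phi] and [f] are the same functions when
    [phi] maps the line through [x] along [v] affinely onto a line along [w]. *)
Lemma is_derive_along {V W : normedModType R} (phi : V -> W) (f : W -> R)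
    x v w df : (forall h, phi (h *: v + x) = h *: w + phi x) ->
  is_derive x v (f \o phi) df <-> is_derive (phi x) w f df.
Proof.
move=> E.
have EE : (fun h : R =>
      h^-1 *: (((f \o phi) \o shift x) (h *: v) - (f \o phi) x)) =
    (fun h : R => h^-1 *: ((f \o shift (phi x)) (h *: w) - f (phi x))).
  by apply/funext => h /=; rewrite E.
have Ed : derivable (f \o phi) x v = derivable f (phi x) w.
  by rewrite /derivable EE.
have Ev : 'D_v (f \o phi) x = 'D_w f (phi x) by rewrite /derive EE.
split=> -[d1 d2]; split; first by rewrite -Ed.
- by rewrite -Ev.
- by rewrite Ed.
- by rewrite Ev.
Qed.

Lemma is_derive_line {V : normedModType R} (f : V -> R) x v df (s : R) :
  is_derive s 1 (fun h : R => f (h *: v + x)) df <->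
  is_derive (s *: v + x) v f df.
Proof.
apply: (@is_derive_along _ _ (fun h : R => h *: v + x)) => h.
by rewrite scalerDl [_%:A]mulr1 addrA.
Qed.

Lemma is_derive_line0 {V : normedModType R} (f : V -> R) x v df :
  is_derive (0 : R) 1 (fun h : R => f (h *: v + x)) df <-> is_derive x v f df.
Proof.
by rewrite -[X in is_derive X v]add0r -(scale0r v); exact: is_derive_line.
Qed.

Lemma smooth_on_coord {n} (A : set 'rV[R]_n) (i : 'I_n) : open A ->
  smooth_on A (fun x => x ord0 i).
Proof.
move=> oA; apply: (@smooth_on_coind _ _ (fun f =>
  f = (fun x => x ord0 i) \/ exists c, f = cst c)) => //; last by left.
have dx (j : 'I_n) (x : 'rV[R]_n) :
    is_derive x (delta_mx ord0 j) (fun x : 'rV[R]_n => x ord0 i) (i == j)%:R.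
  apply/is_derive_line0.
  have -> : (fun h : R => (h *: delta_mx ord0 j + x) ord0 i) =
      (fun h => (i == j)%:R * h + x ord0 i).
    by apply/funext => h; rewrite !mxE eqxx mulrC.
  by apply: is_derive_eq; rewrite addr0 [_ *: _]mulr1.
move=> _ [->|[c ->]]; split.
- by move=> x _; split=> [|j]; [exact: coord_continuous|have [] := dx j x].
- move=> j; exists (cst (i == j)%:R); first by right; exists (i == j)%:R.
  by move=> x _; have [] := dx j x.
- by move=> x _; split; [exact: cst_continuous|move=> j; exact: derivable_cst].
- move=> j; exists (cst 0); first by right; exists 0.
  by move=> x _; exact: derive_cst.
Qed.

(** Closing smooth functions under all operations at once makes the class stable
    under partial derivatives, so that one coinduction suffices for sums, products
    and real powers; [x^-1] is included as a power. *)
Inductive smooth_expr {n} (A : set 'rV[R]_n) : ('rV[R]_n -> R) -> Prop :=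
| SmoothBase f : smooth_on A f -> smooth_expr A f
| SmoothAdd f g : smooth_expr A f -> smooth_expr A g ->
    smooth_expr A (fun x => f x + g x)
| SmoothMul f g : smooth_expr A f -> smooth_expr A g ->
    smooth_expr A (fun x => f x * g x)
| SmoothPow f r : (forall x, A x -> 0 < f x) -> smooth_expr A f ->
    smooth_expr A (fun x => f x `^ r).

Lemma is_derive_powR {V : normedModType R} (f : V -> R) (r df : R) (x v : V) :
  0 < f x -> is_derive x v f df ->
  is_derive x v (fun y => f y `^ r) (r * f x `^ (r - 1) * df).
Proof.
move=> f0 /is_derive_line0 d1; apply/is_derive_line0.
apply: (@is_derive1_comp _ (fun y => y `^ r)) d1.
by rewrite scale0r add0r; exact: is_derive1_powR.
Qed.

Lemma continuous_powR_comp {T : topologicalType} (f : T -> R) (r : R) x :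
  0 < f x -> {for x, continuous f} -> {for x, continuous (fun y => f y `^ r)}.
Proof.
move=> f0 cf; apply: (@continuous_comp _ _ _ f (fun y => y `^ r)) => //.
apply/differentiable_continuous/derivable1_diffP.
by have [] := is_derive1_powR r f0.
Qed.

Lemma smooth_expr_smooth {n} (A : set 'rV[R]_n) f : open A ->
  smooth_expr A f -> smooth_on A f.
Proof.
move=> oA; apply: smooth_on_coind => // {}f.
elim=> {f} [f sf|f g _ [df IHf] _ [dg IHg]|f g ef [df IHf] eg [dg IHg]
  |f r f0 ef [df IHf]].
- split=> [|j]; first exact: smooth_on_partially_derivable.
  exists (fun x => 'D_(delta_mx ord0 j) f x) => //.
  by constructor; exact: smooth_on_partial.
- split=> [x Ax|j].
    have [cf {}df] := df x Ax; have [cg {}dg] := dg x Ax.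
    by split; [exact: continuousD|move=> j; exact: derivableD].
  have [f' ef' ff'] := IHf j; have [g' eg' gg'] := IHg j.
  exists (fun x => f' x + g' x); first exact: SmoothAdd.
  move=> x Ax; have [cf /(_ j) {}df] := df x Ax; have [cg /(_ j) {}dg] := dg x Ax.
  by rewrite -ff'// -gg'// -deriveD.
- split=> [x Ax|j].
    have [cf {}df] := df x Ax; have [cg {}dg] := dg x Ax.
    by split; [exact: continuousM|move=> j; exact: derivableM].
  have [f' ef' ff'] := IHf j; have [g' eg' gg'] := IHg j.
  exists (fun x => f x * g' x + g x * f' x).
    by apply: SmoothAdd; apply: SmoothMul.
  move=> x Ax; have [cf /(_ j) {}df] := df x Ax; have [cg /(_ j) {}dg] := dg x Ax.
  have E := deriveM df dg.
  by rewrite -(ff' x Ax) -(gg' x Ax) [LHS]E.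
- split=> [x Ax|j].
    have [cf {}df] := df x Ax.
    split; first exact: continuous_powR_comp (f0 _ Ax) cf.
    move=> j; have /derivableP dfj := df j.
    by have [] := is_derive_powR r (f0 _ Ax) dfj.
  have [f' ef' ff'] := IHf j.
  exists (fun x => (r * f x `^ (r - 1)) * f' x).
    apply: SmoothMul => //; apply: SmoothMul; last exact: SmoothPow.
    by constructor; exact: smooth_on_cst.
  move=> x Ax; have [_ /(_ j)/derivableP dfj] := df x Ax.
  by rewrite -ff'//; have [_ ->] := is_derive_powR r (f0 _ Ax) dfj.
Qed.

Lemma smooth_onD {n} (A : set 'rV[R]_n) f g : open A ->
  smooth_on A f -> smooth_on A g -> smooth_on A (fun x => f x + g x).
Proof.
move=> oA sf sg; apply: smooth_expr_smooth => //.
by apply: SmoothAdd; constructor.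
Qed.

Lemma smooth_onM {n} (A : set 'rV[R]_n) f g : open A ->
  smooth_on A f -> smooth_on A g -> smooth_on A (fun x => f x * g x).
Proof.
move=> oA sf sg; apply: smooth_expr_smooth => //.
by apply: SmoothMul; constructor.
Qed.

Lemma smooth_on_powR {n} (A : set 'rV[R]_n) f r : open A ->
  (forall x, A x -> 0 < f x) -> smooth_on A f ->
  smooth_on A (fun x => f x `^ r).
Proof.
move=> oA f0 sf; apply: smooth_expr_smooth => //.
by apply: SmoothPow => //; constructor.
Qed.

(** Maps each of whose restrictions to a coordinate line is either a translation
    along a coordinate line or constant, such as projections and insertions.
    Composition with them permutes or kills partial derivatives; this is all that
    is needed of a chain rule in several variables. *)
Definition coordinate_map {m n} (phi : 'rV[R]_m -> 'rV[R]_n) :=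
  continuous phi /\ forall j,
   (exists i, forall h x, phi (h *: delta_mx ord0 j + x) =
                          h *: delta_mx ord0 i + phi x) \/
   (forall h x, phi (h *: delta_mx ord0 j + x) = phi x).

Lemma smooth_on_comp_coordinate {m n} (phi : 'rV[R]_m -> 'rV[R]_n) A B f :
  open A -> coordinate_map phi -> (forall x, A x -> B (phi x)) ->
  smooth_on B f -> smooth_on A (f \o phi).
Proof.
move=> oA [cphi phij] AB sf.
apply: (@smooth_on_coind _ _ (fun h => exists2 f, smooth_on B f &
  h = f \o phi \/ h = cst 0)) => //; last by exists f => //; left.
move=> {sf} _ [{}f sf [->|->]]; last first.
  split=> [x Ax|j].
    by split; [exact: cst_continuous|move=> j; exact: derivable_cst].
  by exists (cst 0); [exists f => //; right|move=> x Ax; exact: derive_cst].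
split=> [x Ax|j].
  have [cf df] := smooth_on_partially_derivable sf (AB _ Ax).
  split; first by apply: continuous_comp => //; exact: cphi.
  move=> j; have [[i E]|E] := phij j.
    by have [] := (is_derive_along f _ (fun h => E h x)).2 (derivableP (df i)).
  apply: (@ex_derive _ _ _ _ _ _ 0).
  by apply/(@is_derive_along _ _ phi f x _ 0) => [h|];
    [rewrite scaler0 add0r E|exact: is_derive0].
have [[i E]|E] := phij j.
  exists ((fun x => 'D_(delta_mx ord0 i) f x) \o phi).
    exists (fun x => 'D_(delta_mx ord0 i) f x); first exact: smooth_on_partial.
    by left.
  move=> x Ax; have [_ df] := smooth_on_partially_derivable sf (AB _ Ax).
  by have [_ ->] := (is_derive_along f _ (fun h => E h x)).2 (derivableP (df i)).
exists (cst 0); first by exists f => //; right.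
move=> x Ax; apply: derive_val.
by apply/(@is_derive_along _ _ phi f x _ 0) => [h|];
    [rewrite scaler0 add0r E|exact: is_derive0].
Qed.

(** The mean value theorem on a segment, for [h] of either sign. *)
Lemma derive_MVT {V : normedModType R} (f : V -> R) y u (h : R) :
  (forall s : R, `|s| <= `|h| -> derivable f (s *: u + y) u) ->
  exists2 s, `|s| <= `|h| & f (h *: u + y) - f y = h * 'D_u f (s *: u + y).
Proof.
move=> df.
pose g (s : R) := f (s *: u + y).
have dg (s : R) : `|s| <= `|h| -> is_derive s 1 g ('D_u f (s *: u + y)).
  by move=> sh; apply/is_derive_line/derivableP/df.
have cg (a b : R) : (forall s, s \in `[a, b]%R -> `|s| <= `|h|) ->
    {within `[a, b], continuous g}.
  move=> ab; apply: derivable_within_continuous => s /ab/dg ds.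
  by have [] := ds.
have g0 : g 0 = f y by rewrite /g scale0r add0r.
have [h0|h0] := leP 0 h.
  have ab s : s \in `[0, h]%R -> `|s| <= `|h|.
    by rewrite in_itv/= => /andP[s0 sh]; rewrite !ger0_norm.
  have dgo s : s \in `]0, h[%R -> is_derive s 1 g ('D_u f (s *: u + y)).
    by move=> s0h; apply: dg; apply: ab; exact: subset_itv_oo_cc s0h.
  have [s /ab sh E] := MVT_segment h0 dgo (cg _ _ ab).
  by exists s => //; rewrite -g0 [LHS]E subr0 mulrC.
have ab s : s \in `[h, 0]%R -> `|s| <= `|h|.
  rewrite in_itv/= => /andP[s0 sh]; rewrite !ler0_norm ?lerN2//.
  exact: ltW.
have dgo s : s \in `]h, 0[%R -> is_derive s 1 g ('D_u f (s *: u + y)).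
  by move=> s0h; apply: dg; apply: ab; exact: subset_itv_oo_cc s0h.
have [s /ab sh E] := MVT_segment (ltW h0) dgo (cg _ _ ab).
exists s => //; apply: oppr_inj.
by rewrite opprB -g0 [LHS]E sub0r mulrN mulrC.
Qed.

(** Additivity in the direction, which fails without a continuity hypothesis:
    the increment along [u + v] is one along [v], followed by one along [u] that
    the mean value theorem evaluates near [x]. *)
Lemma derive_add_direction {V : normedModType R} (f : V -> R) x u v :
  (\forall y \near x, derivable f y u) ->
  {for x, continuous (fun y => 'D_u f y)} ->
  derivable f x v ->
  is_derive x (u + v) f ('D_u f x + 'D_v f x).
Proof.
move=> du cu dv.
suff H : (fun h : R => h^-1 *: ((f \o shift x) (h *: (u + v)) - f x)) @ 0^'
    --> 'D_u f x + 'D_v f x.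
  by split; [apply/cvg_ex; exists ('D_u f x + 'D_v f x)|exact: cvg_lim].
set N := `|u| + `|v| + 1.
have N0 : 0 < N by rewrite /N; have := normr_ge0 u; have := normr_ge0 v; lra.
have small (e s h : R) : `|s| <= `|h| -> `|h| < e / N ->
    ball x e (s *: u + (h *: v + x)).
  move=> sh; rewrite ltr_pdivlMr// => he; rewrite -ball_normE /ball_/=.
  rewrite -normrN opprB addrA addrK (le_lt_trans (ler_normD _ _))// !normrZ.
  apply: le_lt_trans he; rewrite /N mulrDr mulr1 mulrDr -addrA lerD//.
    by rewrite ler_wpM2r.
  by rewrite lerDl.
apply/cvgrPdist_lt => e e0.
have /nbhs_ballP[e1 /= e10 He1] := du.
have e20 : 0 < e / 2 by lra.
have /cvgrPdist_lt/(_ _ e20)/nbhs_ballP[e2 /= e2_0 He2] := cu.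
have /cvgrPdist_lt/(_ _ e20) Hv := dv.
near=> h.
have h0 : h != 0 by near: h; exact: nbhs_dnbhs_neq.
have h1 : `|h| < e1 / N.
  by near: h; apply: dnbhs0_lt; rewrite divr_gt0.
have h2 : `|h| < e2 / N.
  by near: h; apply: dnbhs0_lt; rewrite divr_gt0.
have [s Ps|s sh Es] := @derive_MVT _ f (h *: v + x) u h.
  by apply: He1; exact: small.
have -> : h^-1 *: ((f \o shift x) (h *: (u + v)) - f x) =
  'D_u f (s *: u + (h *: v + x)) + h^-1 *: ((f \o shift x) (h *: v) - f x).
  rewrite /= [h *: (u + v)]scalerDr -[_ + _ + x]addrA.
  have -> : f (h *: u + (h *: v + x)) - f x =
    h * 'D_u f (s *: u + (h *: v + x)) + (f (h *: v + x) - f x).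
    by rewrite -Es [RHS]addrA subrK.
  by rewrite scalerDr [h^-1 *: (h * _)]mulKf.
rewrite opprD addrACA (le_lt_trans (ler_normD _ _))//.
rewrite [ltRHS](splitr e) ltrD//; first by apply: He2; exact: small.
by near: h.
Unshelve. all: by end_near. Qed.

Lemma derive_scale_direction {V : normedModType R} (f : V -> R) x (c : R) u :
  derivable f x u -> is_derive x (c *: u) f (c * 'D_u f x).
Proof.
move=> /derivableP/is_derive_line0 du; apply/is_derive_line0.
have gc : is_derive (0:R) 1 (fun s : R => c * s) c.
  by apply: is_derive_eq; rewrite [_%:A]mulr1.
have -> : (fun h : R => f (h *: (c *: u) + x)) =
  (fun h : R => f (h *: u + x)) \o (fun s : R => c * s).
  by apply/funext => h /=; rewrite scalerA mulrC.
by rewrite mulrC; apply: is_derive1_comp; rewrite mulr0.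
Qed.

End smooth_functions.

(** * Compactness and row vectors *)

Section compact_uniformity.
Context {R : realType} {T S : topologicalType}.

(** The tube lemma, in the form in which uniformity over a compact set is used
    throughout. *)
Lemma compact_uniform_near (K : set T) (g : S -> T -> R) s0 (e : R) :
  compact K ->
  (forall x, K x -> {for (x, s0), continuous (fun z : T * S => g z.2 z.1)}) ->
  0 < e -> \forall s \near s0, forall x, K x -> `|g s x - g s0 x| < e.
Proof.
move=> cK cg e0; have e20 : 0 < e / 2 by lra.
move/compact_near_coveringP : cK.
apply=> x /cg /cvgrPdist_lt /(_ _ e20) [[U V] /= [nU nV] UV].
exists (U, V) => // -[x' s] /= [Ux' Vs].
have H1 := UV (x', s) (conj Ux' Vs).
have H2 := UV (x', s0) (conj Ux' (nbhs_singleton nV)).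
rewrite /= in H1 H2.
rewrite [ltRHS](splitr e) -(subrKA (g s0 x)) (le_lt_trans (ler_normD _ _))//.
by rewrite ltrD// distrC.
Qed.

End compact_uniformity.

Section row_vectors.
Context {R : realType}.

Lemma rV_continuous {T : topologicalType} {n} (phi : T -> 'rV[R]_n) x :
  (forall j, {for x, continuous (fun y => phi y ord0 j)}) ->
  {for x, continuous phi}.
Proof.
move=> cphi; apply/cvg_ballP => e e0.
have : \forall y \near x, forall j, ball (phi x ord0 j) e (phi y ord0 j).
  by apply: filter_forall => j; have /cvg_ballP/(_ e e0) := cphi j.
by apply: filterS => y Hy; split=> // i j; rewrite (ord1 i).
Qed.

Lemma row_mx_continuous {T : topologicalType} {m n} (f : T -> 'rV[R]_m)
    (g : T -> 'rV[R]_n) x : {for x, continuous f} -> {for x, continuous g} ->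
  {for x, continuous (fun y => row_mx (f y) (g y))}.
Proof.
move=> cf cg; apply: rV_continuous => j; have [i ->|i ->] := split_ordP j.
  have -> : (fun y => row_mx (f y) (g y) ord0 (lshift n i)) =
    (fun y => f y ord0 i) by apply/funext => y; rewrite row_mxEl.
  apply: (@continuous_comp _ _ _ f (fun v => v ord0 i)) => //.
  exact: coord_continuous.
have -> : (fun y => row_mx (f y) (g y) ord0 (rshift m i)) =
  (fun y => g y ord0 i) by apply/funext => y; rewrite row_mxEr.
apply: (@continuous_comp _ _ _ g (fun v => v ord0 i)) => //.
exact: coord_continuous.
Qed.

Lemma scalar_mx_continuous : continuous (fun t : R => t%:M : 'rV[R]_1).
Proof.
move=> t; apply: rV_continuous => j.
have -> : (fun t : R => (t%:M : 'rV[R]_1) ord0 j) = id.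
  by apply/funext => s; rewrite mxE (ord1 j) eqxx mulr1n.
exact: cvg_id.
Qed.

Lemma normr_coord {n} (x : 'rV[R]_n) j : `|x ord0 j| <= `|x|.
Proof.
rewrite [leRHS]/Num.norm /= mx_normrE; apply/bigmax_geP; right => /=.
by exists (ord0, j).
Qed.

Lemma normr_le_coord {n} (x : 'rV[R]_n) (c : R) : 0 <= c ->
  (forall j, `|x ord0 j| <= c) -> `|x| <= c.
Proof.
move=> c0 xc; rewrite /Num.norm /= mx_normrE.
apply/bigmax_leP; split=> //= -[i j] _.
by rewrite /= (ord1 i).
Qed.

Lemma normr_row_mxl {m n} (x : 'rV[R]_m) (y : 'rV[R]_n) : `|x| <= `|row_mx x y|.
Proof.
apply: normr_le_coord => // j.
by rewrite -(row_mxEl x y); exact: normr_coord.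
Qed.

Lemma normr_row_mxr {m n} (x : 'rV[R]_m) (y : 'rV[R]_n) : `|y| <= `|row_mx x y|.
Proof.
apply: normr_le_coord => // j.
by rewrite -(row_mxEr x y); exact: normr_coord.
Qed.

Lemma normr_scalar_mx (t : R) : `|t| <= `|t%:M : 'rV[R]_1|.
Proof. by have := normr_coord (t%:M : 'rV[R]_1) ord0; rewrite mxE eqxx. Qed.

Lemma norm_ball_compact n (B : R) : compact [set x : 'rV[R]_n | `|x| <= B].
Proof.
apply: bounded_closed_compact.
  exists B; split; first exact: num_real.
  by move=> M BM x /= /le_trans; apply; exact: ltW.
apply: (@closed_comp _ _ (@Num.norm _ 'rV[R]_n) [set y | y <= B]).
  by move=> x _; exact: norm_continuous.
exact: closed_le.
Qed.

End row_vectors.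

(** * Iterated integrals of compactly supported functions *)

Section integration.
Context {R : realType}.
Notation mu := (@lebesgue_measure R).

Definition supported_continuous {V : normedModType R} (B : R) (f : V -> R) :=
  continuous f /\ forall x, B < `|x| -> f x = 0.

Lemma supported_continuousZD {V : normedModType R} B r (f g : V -> R) :
  supported_continuous B f -> supported_continuous B g ->
  supported_continuous B (fun x => r * f x + g x).
Proof.
move=> [cf f0] [cg g0]; split=> [x|x Bx]; last by rewrite f0// g0// mulr0 addr0.
by apply: cvgD; [apply: cvgM; [exact: cvg_cst|exact: cf]|exact: cg].
Qed.

Lemma supported_integrable B (f : R -> R) : supported_continuous B f ->
  mu.-integrable `[- B, B] (EFin \o f).
Proof.
move=> [cf _]; apply: continuous_compact_integrable.
  exact: segment_compact.
exact: continuous_subspaceT.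
Qed.

Lemma supported_RintegralE B (f : R -> R) : supported_continuous B f ->
  \int[mu]_(x in [set: R]) f x = \int[mu]_(x in `[- B, B]) f x.
Proof.
move=> [_ f0]; rewrite [RHS]Rintegral_mkcond; apply: eq_Rintegral => x _.
rewrite patchE; case: ifPn => // /negP.
rewrite inE /= in_itv/= -ler_norml => /negP.
by rewrite -ltNge => /f0.
Qed.

Lemma supported_Rintegral_linear B r (f g : R -> R) :
  supported_continuous B f -> supported_continuous B g ->
  \int[mu]_(x in [set: R]) (r * f x + g x) =
  r * \int[mu]_(x in [set: R]) f x + \int[mu]_(x in [set: R]) g x.
Proof.
move=> sf sg; have := supported_integrable sf; have := supported_integrable sg.
rewrite (supported_RintegralE sf) (supported_RintegralE sg).
rewrite (supported_RintegralE (supported_continuousZD r sf sg)) => ig jf.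
rewrite -RintegralZl// RintegralD//; apply: supported_integrable.
split=> [x|x Bx]; last by rewrite sf.2// mulr0.
by apply: cvgM; [exact: cvg_cst|exact: sf.1].
Qed.

Lemma supported_Rintegral_bound B (e : R) (f : R -> R) : 0 <= B ->
  supported_continuous B f -> (forall x, `|f x| <= e) ->
  `|\int[mu]_(x in [set: R]) f x| <= B *+ 2 * e.
Proof.
move=> B0 sf fe; rewrite (supported_RintegralE sf).
rewrite (le_trans (le_normr_Rintegral _ (supported_integrable sf)))//.
have -> : B *+ 2 * e = \int[mu]_(x in `[- B, B]) e.
  rewrite Rintegral_cst//= lebesgue_measure_itv /= lte_fin mulrC.
  case: ltP => [_|B1]; first by rewrite /= opprK mulr2n.
  have -> : B = 0 by lra.
  by rewrite mul0rn.
apply: le_Rintegral => //.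
- apply: (@supported_integrable B (fun x => `|f x|)); split=> [x|x Bx].
    by apply: cvg_norm; exact: sf.1.
  by rewrite sf.2// normr0.
- apply: continuous_compact_integrable; first exact: segment_compact.
  by apply: continuous_subspaceT; exact: cst_continuous.
Qed.

(** The integrand exceeds [f x0 / 2] on a short interval starting at [x0]. *)
Lemma supported_Rintegral_gt0 B (f : R -> R) x0 :
  supported_continuous B f -> (forall x, 0 <= f x) -> 0 < f x0 ->
  0 < \int[mu]_(x in [set: R]) f x.
Proof.
move=> sf f0 fx0; have cf := sf.1.
have e0 : 0 < f x0 / 2 by lra.
have /cvgrPdist_lt/(_ _ e0)/nbhs_ballP[d /= d0 Hd] := cf x0.
(* The radius is enlarged so that this interval lies in the domain. *)
pose B' := Num.max B (`|x0| + d).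
have sf' : supported_continuous B' f.
  by split=> // x; rewrite /B' gt_max => /andP[Bx _]; exact: sf.2.
have sub : `[x0, x0 + d / 2] `<=` `[- B', B'].
  move=> x /=; rewrite !in_itv/= => /andP[x1 x2].
  have : `|x0| + d <= B' by rewrite /B' le_max lexx orbT.
  have := ler_norm x0; have := ler_norm (- x0); rewrite normrN; lra.
rewrite (supported_RintegralE sf').
have itf := supported_integrable sf'.
have itg : mu.-integrable `[x0, x0 + d / 2] (EFin \o f).
  exact: integrableS itf.
apply: lt_le_trans (_ : \int[mu]_(x in `[x0, x0 + d / 2]) f x <= _); last first.
  rewrite /Rintegral fine_le//; [exact: integrable_fin_num..|].
  apply: ge0_subset_integral => //; first exact: measurable_int itf.
  by move=> x _; rewrite lee_fin.
apply: lt_le_trans (_ : \int[mu]_(x in `[x0, x0 + d / 2]) (f x0 / 2) <= _).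
  rewrite Rintegral_cst//= lebesgue_measure_itv /= lte_fin ltrDl divr_gt0//=.
  by rewrite mulr_gt0//; lra.
apply: le_Rintegral => //.
  apply: continuous_compact_integrable; first exact: segment_compact.
  by apply: continuous_subspaceT; exact: cst_continuous.
move=> x; rewrite /= in_itv/= => /andP[x1 x2].
have /Hd : ball x0 d x.
  by rewrite -ball_normE /ball_/= ltr_norml; apply/andP; split; lra.
by rewrite /= ltr_norml => /andP[]; lra.
Qed.

Definition slice {n} (f : 'rV[R]_n.+1 -> R) (t : R) (x : 'rV[R]_n) : R :=
  f (row_mx (t%:M : 'rV[R]_1) x : 'rV[R]_n.+1).

Lemma integral_rVS n (f : 'rV[R]_n.+1 -> R) :
  integral_rV f = \int[mu]_(t in [set: R]) integral_rV (slice f t).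
Proof. by []. Qed.

Lemma slice_supported n B (f : 'rV[R]_n.+1 -> R) t :
  supported_continuous B f -> supported_continuous B (slice f t).
Proof.
move=> [cf f0]; split=> [x|x Bx]; last first.
  by apply: f0; exact: lt_le_trans Bx (@normr_row_mxr R 1 n t%:M x).
apply: (@continuous_comp _ _ _
  (fun x : 'rV_n => row_mx (t%:M : 'rV[R]_1) x : 'rV_n.+1) f).
  apply: (@row_mx_continuous R _ 1 n (fun=> t%:M) id x); last exact: cvg_id.
  exact: cst_continuous.
exact: cf.
Qed.

Lemma integral_rV_ge0 n (f : 'rV[R]_n -> R) :
  (forall x, 0 <= f x) -> 0 <= integral_rV f.
Proof.
elim: n f => [|n IH] f f0 /=; first exact: f0.
by apply: Rintegral_ge0 => t _; apply: IH.
Qed.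

(** The three facts are proved together because the inner integral must be known
    to be continuous in the outer variable before the one-dimensional results
    apply, and this follows from linearity and the bound in lower dimension.
    Thus Fubini and measurability in several variables are avoided. *)
Lemma integral_rV_facts n (B : R) : 0 <= B ->
  [/\ forall r (f g : 'rV[R]_n -> R),
        supported_continuous B f -> supported_continuous B g ->
        integral_rV (fun x => r * f x + g x) =
        r * integral_rV f + integral_rV g,
      forall (e : R) (f : 'rV[R]_n -> R), supported_continuous B f ->
        (forall x, `|f x| <= e) -> `|integral_rV f| <= (B *+ 2) ^+ n * e &
      forall (f : 'rV[R]_n -> R) x0, supported_continuous B f ->
        (forall x, 0 <= f x) -> 0 < f x0 -> 0 < integral_rV f].
Proof.
move=> B0; elim: n => [|n [IHl IHb IHp]].
  split=> //= [e f _ fe|f x0 _ _]; first by rewrite expr0 mul1r.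
  by rewrite [x0]thinmx0.
have F0 (f : 'rV[R]_n.+1 -> R) : supported_continuous B f ->
    supported_continuous B (fun t => integral_rV (slice f t)).
  move=> sf; split; last first.
    move=> t Bt; have := IHb 0 (slice f t) (slice_supported t sf).
    rewrite mulr0 normr_le0 => E; apply/eqP/E => x.
    rewrite /slice sf.2 ?normr0//; apply: lt_le_trans (@normr_row_mxl R 1 n t%:M x).
    exact: lt_le_trans Bt (normr_scalar_mx _).
  move=> t0; apply/cvgrPdist_le => e e0.
  (* Adding 1 avoids a division by zero when [B = 0]. *)
  pose c := (B *+ 2) ^+ n + 1.
  have c0 : 0 < c by rewrite ltr_wpDl// exprn_ge0// mulrn_wge0.
  have cf (x : 'rV[R]_n) : `|x| <= B ->
      {for (x, t0), continuous (fun z : 'rV[R]_n * R => slice f z.2 z.1)}.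
    move=> _; apply: (@continuous_comp _ _ _
      (fun z : 'rV[R]_n * R => row_mx (z.2%:M : 'rV[R]_1) z.1 : 'rV_n.+1) f);
      last exact: sf.1.
    apply: (@row_mx_continuous R _ 1 n (fun z => z.2%:M) fst);
      last exact: cvg_fst.
    apply: (@continuous_comp _ _ _ snd (fun t : R => t%:M : 'rV[R]_1)).
      exact: cvg_snd.
    exact: scalar_mx_continuous.
  have := compact_uniform_near (@norm_ball_compact R n B) cf (divr_gt0 e0 c0).
  apply: filterS => t Ht.
  have -> : integral_rV (slice f t0) - integral_rV (slice f t) =
    integral_rV (fun x => -1 * slice f t x + slice f t0 x).
    by rewrite IHl ?mulN1r 1?addrC//; exact: slice_supported.
  apply: le_trans (IHb (e / c) _ _ _) _.
  - by apply: supported_continuousZD; exact: slice_supported.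
  - move=> x; have [xB|Bx] := leP `|x| B.
      by rewrite mulN1r addrC distrC; exact/ltW/Ht.
    rewrite (slice_supported t sf).2// (slice_supported t0 sf).2//.
    by rewrite mulr0 addr0 normr0 divr_ge0 ?ltW.
  - rewrite mulrCA ger_pMr// ler_pdivrMr// mul1r /c; lra.
split.
- move=> r f g sf sg; rewrite !integral_rVS.
  rewrite -(supported_Rintegral_linear r (F0 _ sf) (F0 _ sg)).
  by apply: eq_Rintegral => t _; apply: IHl; exact: slice_supported.
- move=> e f sf fe; rewrite integral_rVS exprS -mulrA.
  apply: supported_Rintegral_bound => //; first exact: F0.
  by move=> t; apply: IHb => //; [exact: slice_supported|move=> x; exact: fe].
- move=> f x0 sf f0 fx0; rewrite integral_rVS.
  apply: (@supported_Rintegral_gt0 B _ ((lsubmx (x0 : 'rV_(1 + n))) ord0 ord0)).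
  + exact: F0.
  + by move=> t; apply: integral_rV_ge0 => x; exact: f0.
  + apply: (IHp _ (rsubmx (x0 : 'rV_(1 + n)))).
    * exact: slice_supported.
    * by move=> x; exact: f0.
    * rewrite /slice -[X in X%:M]/(_ ord0 ord0) -mx11_scalar hsubmxK.
      exact: fx0.
Qed.

End integration.

(** * Changes of parameters *)

Section coordinate_maps.
Context {R : realType}.

Lemma lsubmx_delta_lshift {m n} (j : 'I_m) h (x : 'rV[R]_(m + n)) :
  lsubmx (h *: delta_mx ord0 (lshift n j) + x) =
  h *: delta_mx ord0 j + lsubmx x.
Proof. by apply/rowP => k; rewrite !mxE eq_shift. Qed.

Lemma lsubmx_delta_rshift {m n} (j : 'I_n) h (x : 'rV[R]_(m + n)) :
  lsubmx (h *: delta_mx ord0 (rshift m j) + x) = lsubmx x.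
Proof. by apply/rowP => k; rewrite !mxE eq_shift andbF mulr0 add0r. Qed.

Lemma rsubmx_delta_lshift {m n} (j : 'I_m) h (x : 'rV[R]_(m + n)) :
  rsubmx (h *: delta_mx ord0 (lshift n j) + x) = rsubmx x.
Proof. by apply/rowP => k; rewrite !mxE eq_shift andbF mulr0 add0r. Qed.

Lemma rsubmx_delta_rshift {m n} (j : 'I_n) h (x : 'rV[R]_(m + n)) :
  rsubmx (h *: delta_mx ord0 (rshift m j) + x) =
  h *: delta_mx ord0 j + rsubmx x.
Proof. by apply/rowP => k; rewrite !mxE eq_shift. Qed.

Lemma row_mx_delta_lshift {m n} (j : 'I_m) h (x : 'rV[R]_m) (y : 'rV[R]_n) :
  row_mx (h *: delta_mx ord0 j + x) y =
  h *: delta_mx ord0 (lshift n j) + row_mx x y.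
Proof.
rewrite -[RHS]hsubmxK lsubmx_delta_lshift rsubmx_delta_lshift.
by rewrite row_mxKl row_mxKr.
Qed.

Lemma row_mx_delta_rshift {m n} (j : 'I_n) h (x : 'rV[R]_m) (y : 'rV[R]_n) :
  row_mx x (h *: delta_mx ord0 j + y) =
  h *: delta_mx ord0 (rshift m j) + row_mx x y.
Proof.
rewrite -[RHS]hsubmxK lsubmx_delta_rshift rsubmx_delta_rshift.
by rewrite row_mxKl row_mxKr.
Qed.

Lemma coordinate_map_lsubmx {m n} : coordinate_map (@lsubmx R 1 m n).
Proof.
split=> [|j]; first exact: continuous_lsubmx.
have [i ->|i ->] := split_ordP j; [left; exists i|right] => h x.
  exact: lsubmx_delta_lshift.
exact: lsubmx_delta_rshift.
Qed.

Lemma coordinate_map_rsubmx {m n} : coordinate_map (@rsubmx R 1 m n).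
Proof.
split=> [|j]; first exact: continuous_rsubmx.
have [i ->|i ->] := split_ordP j; [right|left; exists i] => h x.
  exact: rsubmx_delta_lshift.
exact: rsubmx_delta_rshift.
Qed.

Lemma coordinate_map_row_mxl {m n k} (phi : 'rV[R]_m -> 'rV[R]_k) :
  coordinate_map phi ->
  coordinate_map (fun z : 'rV[R]_(m + n) => row_mx (phi (lsubmx z)) (rsubmx z)).
Proof.
move=> [cphi phij]; split=> [z|j].
  apply: row_mx_continuous; last exact: continuous_rsubmx.
  by apply: (@continuous_comp _ _ _ lsubmx phi);
    [exact: continuous_lsubmx|exact: cphi].
have [i ->|i ->] := split_ordP j; last first.
  left; exists (rshift k i) => h z.
  by rewrite lsubmx_delta_rshift rsubmx_delta_rshift row_mx_delta_rshift.
have [[i' E]|E] := phij i; [left; exists (lshift n i')|right] => h z.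
  by rewrite lsubmx_delta_lshift rsubmx_delta_lshift E row_mx_delta_lshift.
by rewrite lsubmx_delta_lshift rsubmx_delta_lshift E.
Qed.

Lemma open_lsubmx_rsubmx {m n} (A : set 'rV[R]_m) (B : set 'rV[R]_n) :
  open A -> open B ->
  open [set z : 'rV[R]_(m + n) | A (lsubmx z) /\ B (rsubmx z)].
Proof.
move=> oA oB; apply: openI.
  by apply: (@open_comp _ _ (@lsubmx R 1 m n)) => // x _; exact: continuous_lsubmx.
by apply: (@open_comp _ _ (@rsubmx R 1 m n)) => // x _; exact: continuous_rsubmx.
Qed.

Lemma is_derive_row_mx {m n} (F : 'rV[R]_m -> 'rV[R]_n -> R) w x (j : 'I_m) d :
  is_derive (row_mx w x) (delta_mx ord0 (lshift n j))
    (fun z : 'rV[R]_(m + n) => F (lsubmx z) (rsubmx z)) d ->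
  is_derive w (delta_mx ord0 j) (F ^~ x) d.
Proof.
move=> dF; have := @is_derive_along R _ _ (fun v => row_mx v x)
  (fun z : 'rV[R]_(m + n) => F (lsubmx z) (rsubmx z)) w (delta_mx ord0 j)
  (delta_mx ord0 (lshift n j)) d.
move=> /(_ (fun h => row_mx_delta_lshift j h w x)) [_ /(_ dF)].
suff -> : (fun z : 'rV[R]_(m + n) => F (lsubmx z) (rsubmx z)) \o
  (fun v => row_mx v x) = F ^~ x by [].
by apply/funext => v /=; rewrite row_mxKl row_mxKr.
Qed.

End coordinate_maps.

(** * Smooth families of functions on the manifold *)

Section function_families.
Context {R : realType} {n : nat} {M : topologicalType}.
Variable X : oriented_atlas R n M.

(** The analogue of [smooth_family] for functions. *)
Definition smooth_function_family {k} (W : set 'rV[R]_k)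
    (phi : 'rV[R]_k -> M -> R) :=
  forall i, smooth_on
    [set z : 'rV[R]_(k + n) | W (lsubmx z) /\ chart_img i (rsubmx z)]
    (fun z => phi (lsubmx z) (@chart_inv _ _ _ X i (rsubmx z))).

Lemma chart_img_chart i p : chart_dom i p -> chart_img i (@chart _ _ _ X i p).
Proof. by move=> ip; exists p. Qed.

Lemma chart_inv_dom i x : chart_img i x -> chart_dom i (@chart_inv _ _ _ X i x).
Proof. by move=> [p ip <-]; rewrite chartK. Qed.

Lemma chart_invK i x : chart_img i x -> @chart _ _ _ X i (chart_inv i x) = x.
Proof. by move=> [p ip <-]; rewrite chartK. Qed.

Section fixed_domain.
Context {k : nat} {W : set 'rV[R]_k}.
Hypothesis oW : open W.

Let oZ i : open [set z : 'rV[R]_(k + n) |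
  W (lsubmx z) /\ chart_img (X := X) i (rsubmx z)].
Proof. by apply: open_lsubmx_rsubmx => //; exact: chart_img_open. Qed.

Lemma smooth_function_family_ext phi psi :
  (forall w, W w -> phi w = psi w) -> smooth_function_family W phi ->
  smooth_function_family W psi.
Proof.
by move=> E sphi i; apply: smooth_on_ext (sphi i) => // z [Wz _]; rewrite E.
Qed.

Lemma smooth_function_familyD phi psi : smooth_function_family W phi ->
  smooth_function_family W psi ->
  smooth_function_family W (fun w p => phi w p + psi w p).
Proof. by move=> sphi spsi i; exact: smooth_onD. Qed.

Lemma smooth_function_familyM phi psi : smooth_function_family W phi ->
  smooth_function_family W psi ->
  smooth_function_family W (fun w p => phi w p * psi w p).
Proof. by move=> sphi spsi i; exact: smooth_onM. Qed.

Lemma smooth_function_family_powR phi r : (forall w p, W w -> 0 < phi w p) ->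
  smooth_function_family W phi ->
  smooth_function_family W (fun w p => phi w p `^ r).
Proof.
by move=> phi0 sphi i; apply: smooth_on_powR => // z [Wz _]; exact: phi0.
Qed.

Lemma smooth_function_family_scalar F : smooth_on W F ->
  smooth_function_family W (fun w _ => F w).
Proof.
move=> sF i; apply: (@smooth_on_comp_coordinate R _ _ lsubmx _ W F) => //.
  exact: coordinate_map_lsubmx.
by move=> z [].
Qed.

Lemma smooth_function_family_cst f : smooth_function X f ->
  smooth_function_family W (fun _ p => f p).
Proof.
move=> sf i; apply: (@smooth_on_comp_coordinate R _ _ rsubmx _ (chart_img i)
  (f \o chart_inv i)) => //.
  exact: coordinate_map_rsubmx.
by move=> z [].
Qed.

Lemma smooth_function_family_partial phi (j : 'I_k) :
  smooth_function_family W phi ->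
  smooth_function_family W
    (fun w p => 'D_(delta_mx ord0 j) (phi ^~ p) w).
Proof.
move=> sphi i; apply: smooth_on_ext (smooth_on_partial (lshift n j) (sphi i)) => //.
move=> z Az.
have [_ /(_ (lshift n j)) dphi] := smooth_on_partially_derivable (sphi i) Az.
apply/esym/derive_val.
apply: (@is_derive_row_mx R _ _ (fun w x => phi w (@chart_inv _ _ _ X i x))).
by rewrite hsubmxK; exact: derivableP.
Qed.

Lemma smooth_function_family_continuous phi w p :
  smooth_function_family W phi -> W w ->
  {for (p, w), continuous (fun z : M * 'rV[R]_k => phi z.2 z.1)}.
Proof.
move=> sphi Ww; have [i ip] := chart_cover X p.
have Az : [set z : 'rV[R]_(k + n) | W (lsubmx z) /\ chart_img i (rsubmx z)]
    (row_mx w (chart i p)).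
  by rewrite /= row_mxKl row_mxKr; split=> //; exact: chart_img_chart.
have [cphi _] := smooth_on_partially_derivable (sphi i) Az.
apply: (@near_eq_continuous _ _ ((fun z => phi (lsubmx z) (chart_inv i (rsubmx z)))
   \o (fun z : M * 'rV[R]_k => row_mx z.2 (chart i z.1)))).
  exists (chart_dom i, setT) => /=; last first.
    by move=> [p' w'] [/= ip' _]; rewrite row_mxKl row_mxKr chartK.
  split; last exact: filterT.
  by apply: open_nbhs_nbhs; split=> //; exact: chart_dom_open.
apply: continuous_comp; last exact: cphi.
apply: row_mx_continuous; first exact: cvg_snd.
apply: (@continuous_comp _ _ _ fst (@chart _ _ _ X i)); first exact: cvg_fst.
exact: chart_continuous.
Qed.

Lemma smooth_function_family_derivable phi w p (j : 'I_k) :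
  smooth_function_family W phi -> W w ->
  derivable (phi ^~ p) w (delta_mx ord0 j).
Proof.
move=> sphi Ww; have [i ip] := chart_cover X p.
have Az : [set z : 'rV[R]_(k + n) | W (lsubmx z) /\ chart_img i (rsubmx z)]
    (row_mx w (chart i p)).
  by rewrite /= row_mxKl row_mxKr; split=> //; exact: chart_img_chart.
have [_ /(_ (lshift n j))] := smooth_on_partially_derivable (sphi i) Az.
move=> /derivableP /(@is_derive_row_mx R _ _
  (fun w x => phi w (@chart_inv _ _ _ X i x))) [].
by rewrite chartK.
Qed.

End fixed_domain.

Lemma smooth_function_family_comp {k l} (W : set 'rV[R]_k) (V : set 'rV[R]_l)
    (kappa : 'rV[R]_l -> 'rV[R]_k) phi :
  open V -> coordinate_map kappa -> (forall v, V v -> W (kappa v)) ->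
  smooth_function_family W phi ->
  smooth_function_family V (fun v => phi (kappa v)).
Proof.
move=> oV ck VW sphi i.
have oA : open [set z : 'rV[R]_(l + n) |
    V (lsubmx z) /\ chart_img (X := X) i (rsubmx z)].
  by apply: open_lsubmx_rsubmx => //; exact: chart_img_open.
have := smooth_on_comp_coordinate oA
  (coordinate_map_row_mxl (n := n) ck) _ (sphi i).
have -> : (fun z => phi (lsubmx z) (@chart_inv _ _ _ X i (rsubmx z))) \o
   (fun z : 'rV_(l + n) => row_mx (kappa (lsubmx z)) (rsubmx z)) =
   (fun z => phi (kappa (lsubmx z)) (@chart_inv _ _ _ X i (rsubmx z))).
  by apply/funext => z /=; rewrite row_mxKl row_mxKr.
apply=> z /= [Vz iz]; rewrite row_mxKl row_mxKr; split=> //; exact: VW.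
Qed.

Lemma smooth_family_point {k} (W : set 'rV[R]_k) phi p : open W ->
  smooth_function_family W phi -> smooth_on W (phi ^~ p).
Proof.
move=> oW sphi; have [i ip] := chart_cover X p.
have cp : coordinate_map (fun w : 'rV[R]_k => row_mx w (@chart _ _ _ X i p)).
  split=> [x|j].
    apply: (@row_mx_continuous R _ k n id (fun=> chart i p) x).
      exact: cvg_id.
    exact: cst_continuous.
  by left; exists (lshift n j) => h x; exact: row_mx_delta_lshift.
have := smooth_on_comp_coordinate oW cp _ (sphi i).
have -> : (fun z => phi (lsubmx z) (@chart_inv _ _ _ X i (rsubmx z))) \o
   (fun w : 'rV_k => row_mx w (chart i p)) = phi ^~ p.
  by apply/funext => z /=; rewrite row_mxKl row_mxKr chartK.
apply=> x ix; rewrite /= row_mxKl row_mxKr; split=> //; exact: chart_img_chart.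
Qed.

Lemma smooth_family_at {k} (W : set 'rV[R]_k) phi w : open W -> W w ->
  smooth_function_family W phi -> smooth_function X (phi w).
Proof.
move=> oW Ww sphi i; have oi : open (chart_img (X := X) i) by exact: chart_img_open.
have cw : coordinate_map (fun x : 'rV[R]_n => row_mx w x).
  split=> [x|j].
    by apply: row_mx_continuous; [exact: cst_continuous|exact: cvg_id].
  by left; exists (rshift k j) => h x; exact: row_mx_delta_rshift.
have := smooth_on_comp_coordinate oi cw _ (sphi i).
have -> : (fun z => phi (lsubmx z) (@chart_inv _ _ _ X i (rsubmx z))) \o
   (fun x : 'rV_n => row_mx w x) = phi w \o @chart_inv _ _ _ X i.
  by apply/funext => z /=; rewrite row_mxKl row_mxKr.
by apply=> x ix; rewrite /= row_mxKl row_mxKr.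
Qed.

(** A function is a family over [R^0], for which joint continuity is known. *)
Lemma smooth_function_continuous f : smooth_function X f -> continuous f.
Proof.
move=> sf p.
have s0 := smooth_function_family_cst (@openT 'rV[R]_0) sf.
have := @smooth_function_family_continuous 0 setT _ 0 p s0 I => cf.
apply: (@continuous_comp _ _ _ (fun q : M => (q, 0 : 'rV[R]_0))
  (fun z : M * 'rV[R]_0 => f z.1) p); last exact: cf.
apply: (@cvg_pair _ _ _ (nbhs p) (nbhs p) (nbhs (0 : 'rV[R]_0))).
  exact: cvg_id.
exact: cvg_cst.
Qed.

Hypothesis cM : compact [set: M].

(** Positivity of a function on [M] is an open condition on the parameter because
    [M] is compact. *)
Lemma open_family_gt0 {k} (W : set 'rV[R]_k) phi : open W ->
  smooth_function_family W phi ->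
  open [set w | W w /\ forall p, 0 < phi w p].
Proof.
move=> oW sphi; rewrite openE => w [Ww phi0].
have nW : \forall v \near w, W v by exact: open_nbhs_nbhs.
have nphi : \forall v \near w, forall p, [set: M] p -> 0 < phi v p.
  move/compact_near_coveringP : cM =>
    /(_ _ (nbhs w) (fun v p => 0 < phi v p) _).
  apply=> p _.
  have := smooth_function_family_continuous (p := p) sphi Ww.
  by move=> /cvgr_gt /(_ 0 (phi0 p)).
near=> v; split; first by near: v.
by move=> p; have := near nphi v; apply.
Unshelve. all: by end_near. Qed.

End function_families.

(** * Integration against a density *)

Section integral_against_density.
Context {R : realType} {n : nat} {M : topologicalType}.
Variables (X : oriented_atlas R n M) (P : partition_of_unity X).
Hypothesis cM : compact [set: M].
Variable lambda : top_form X.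
Hypothesis lambda_dens : Dens lambda.

Definition integral_against (f : M -> R) : R :=
  integral_form P (fscale f lambda).
Local Notation J := integral_against.

(** The term of index [k] in the definition of [integral_form]. *)
Let localized (k : 'I_(pou_size P)) (f : M -> R) (x : 'rV[R]_n) : R :=
  if x \in chart_img (pou_chart k)
  then fscale (pou_fun k) (fscale f lambda) (pou_chart k)
         (chart_inv (pou_chart k) x)
  else 0.

Let localized_notin k f x : ~ chart_img (pou_chart k) x -> localized k f x = 0.
Proof. by move=> nx; rewrite /localized memNset. Qed.

Let localized_in k f x : chart_img (pou_chart k) x -> localized k f x =
  pou_fun k (chart_inv (pou_chart k) x) * (f (chart_inv (pou_chart k) x) *
    lambda (pou_chart k) (chart_inv (pou_chart k) x)).
Proof. by move=> nx; rewrite /localized mem_set. Qed.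

Let localized_linear k r f g x :
  localized k (fun p => r * f p + g p) x =
  r * localized k f x + localized k g x.
Proof.
have [ix|nix] := pselect (chart_img (pou_chart k) x).
  by rewrite !localized_in//; ring.
by rewrite !localized_notin// mulr0 addr0.
Qed.

Let localized_ge0 k f x : (forall p, 0 <= f p) -> 0 <= localized k f x.
Proof.
move=> f0; have [ix|nix] := pselect (chart_img (pou_chart k) x).
  rewrite localized_in// mulr_ge0 ?pou_ge0// mulr_ge0// ltW// lambda_dens.2//.
  exact: chart_inv_dom.
by rewrite localized_notin.
Qed.

(** The support of a function of the partition of unity is closed in the compact
    [M], so its image in the chart is compact; extension by zero is therefore
    continuous.  The radius [B] does not depend on [f]. *)
Lemma localized_supported : exists2 B : R, 0 <= B &
  forall k f, continuous f -> supported_continuous B (localized k f).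
Proof.
have HK k : exists K : set 'rV[R]_n,
    [/\ compact K, K `<=` chart_img (pou_chart k) &
    forall f x, localized k f x != 0 -> K x].
  exists (chart (pou_chart k) @` closure [set p | pou_fun k p != 0]); split.
  - apply: continuous_compact.
      apply: continuous_in_subspaceT => p /set_mem /pou_support.
      exact: chart_continuous.
    by apply: subclosed_compact cM _ => //; exact: closed_closure.
  - by move=> _ [p /pou_support pk <-]; exact: chart_img_chart.
  move=> f x; have [ix|nix] := pselect (chart_img (pou_chart k) x); last first.
    by rewrite localized_notin// eqxx.
  rewrite localized_in// mulf_eq0 negb_or => /andP[px _].
  by exists (chart_inv (pou_chart k) x);
    [exact: subset_closure|exact: chart_invK].
have cont k f : continuous f -> continuous (localized k f).
  move=> cf x; have [K [cK Ki HKf]] := HK k.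
  have [ix|nix] := pselect (chart_img (pou_chart k) x); last first.
    have oK : open (~` K).
      by rewrite openC; apply: compact_closed => //; exact: norm_hausdorff.
    apply: (@near_eq_continuous R _ (cst 0)); last exact: cst_continuous.
    have nKx : \forall y \near x, (~` K) y.
      by apply: open_nbhs_nbhs; split=> //; move/Ki.
    apply: filterS nKx => y nKy; apply/esym/eqP.
    by apply: contra_notT nKy; exact: HKf.
  have nx : \forall y \near x, chart_img (pou_chart k) y.
    by apply: open_nbhs_nbhs; split=> //; exact: chart_img_open.
  pose inv := @chart_inv _ _ _ X (pou_chart k).
  apply: (@near_eq_continuous R _ (fun y => pou_fun k (inv y) *
      (f (inv y) * lambda (pou_chart k) (inv y)))).
    by apply: filterS nx => y iy; rewrite localized_in.
  have cinv : {for x, continuous inv}.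
    by rewrite -(chart_invK ix); apply: chart_inv_continuous; exact: chart_inv_dom.
  apply: continuousM.
    have sp : smooth_function X (pou_fun k) by exact: pou_smooth.
    by have [] := smooth_on_partially_derivable (sp (pou_chart k)) ix.
  apply: continuousM; first by apply: continuous_comp cinv _; exact: cf.
  have [[_ sl _] _] := lambda_dens.
  by have [] := smooth_on_partially_derivable (sl (pou_chart k)) ix.
have HB k : exists2 B : R, 0 <= B &
    forall f, continuous f -> supported_continuous B (localized k f).
  have [K [cK Ki HKf]] := HK k.
  have [N [_ HN]] := compact_bounded cK.
  exists (`|N| + 1) => [|f cf]; first by rewrite addr_ge0.
  split=> [|x Bx]; first exact: cont.
  apply/eqP; apply: contraTT Bx => /HKf Kx; rewrite -leNgt.
  by apply: HN => //; have := ler_norm N; lra.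
have /(_ _)/cid2 Bk := HB.
(* One radius for all charts. *)
exists (\sum_k s2val (Bk k)) => [|k f cf].
  by apply: sumr_ge0 => k _; exact: (s2valP (Bk k)).
have [cl sl] := s2valP' (Bk k) f cf; split=> // x Bx; apply: sl.
apply: le_lt_trans Bx; rewrite (bigD1 k)//= lerDl.
by apply: sumr_ge0 => i _; exact: (s2valP (Bk i)).
Qed.

Lemma integral_against_linear (r : R) (f g : M -> R) :
  continuous f -> continuous g ->
  J (fun p => r * f p + g p) = r * J f + J g.
Proof.
move=> cf cg; have [B B0 HB] := localized_supported.
have [lin _ _] := @integral_rV_facts R n B B0.
rewrite /integral_against /integral_form mulr_sumr -big_split.
apply: eq_bigr => k _.
apply: etrans (lin r _ _ (HB k f cf) (HB k g cg)); congr integral_rV.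
by apply/funext => x; exact: localized_linear.
Qed.

Lemma integral_against_ge0 (f : M -> R) : (forall p, 0 <= f p) -> 0 <= J f.
Proof.
move=> f0; apply: sumr_ge0 => k _; apply: integral_rV_ge0 => x.
exact: localized_ge0.
Qed.

Lemma integral_against_gt0 (f : M -> R) p :
  continuous f -> (forall q, 0 <= f q) -> 0 < f p -> 0 < J f.
Proof.
move=> cf f0 fp; have [B B0 HB] := localized_supported.
have [_ _ pos] := @integral_rV_facts R n B B0.
have [k pk] : exists k : 'I_(pou_size P), 0 < pou_fun k p.
  apply: contrapT => npk; have := pou_sum P p.
  rewrite big1; first by move/eqP; rewrite eq_sym oner_eq0.
  move=> k _; apply/eqP; rewrite eq_le pou_ge0 andbT leNgt.
  by apply/negP => pk; apply: npk; exists k.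
have pd : chart_dom (pou_chart k) p.
  by apply: pou_support; apply: subset_closure; rewrite /= gt_eqF.
rewrite /integral_against /integral_form (bigD1 k)//= ltr_pwDl//.
  apply: (pos (localized k f) (chart (pou_chart k) p) (HB k f cf)).
    by move=> x; exact: localized_ge0.
  rewrite localized_in ?chartK//; last exact: chart_img_chart.
  by rewrite !mulr_gt0// lambda_dens.2.
by apply: sumr_ge0 => i _; apply: integral_rV_ge0 => x; exact: localized_ge0.
Qed.

Lemma integral_against0 : J (cst 0) = 0.
Proof.
have c0 : continuous (cst 0 : M -> R) by exact: cst_continuous.
have := @integral_against_linear 1 (cst 0) (cst 0) c0 c0.
have -> : (fun p : M => 1 * cst 0 p + cst 0 p) = cst (0 : R).
  by apply/funext => p /=; rewrite mulr0 addr0.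
rewrite mul1r => /eqP; rewrite -subr_eq0 opprD addrA subrr sub0r oppr_eq0.
by move/eqP.
Qed.

Lemma integral_againstZ (r : R) (f : M -> R) : continuous f ->
  J (fun p => r * f p) = r * J f.
Proof.
move=> cf; have c0 : continuous (cst 0 : M -> R) by exact: cst_continuous.
rewrite -[RHS]addr0 -integral_against0 -integral_against_linear//.
by congr J; apply/funext => p /=; rewrite addr0.
Qed.

Lemma integral_againstD (f g : M -> R) : continuous f -> continuous g ->
  J (fun p => f p + g p) = J f + J g.
Proof.
move=> cf cg; rewrite -[J f]mul1r -integral_against_linear//.
by congr J; apply/funext => p; rewrite mul1r.
Qed.

Lemma integral_againstB (f g : M -> R) : continuous f -> continuous g ->
  J (fun p => f p - g p) = J f - J g.
Proof.
move=> cf cg; rewrite addrC -[- J g]mulN1r -integral_against_linear//.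
by congr J; apply/funext => p; rewrite mulN1r addrC.
Qed.

(** Positivity applied to [e - f] and [e + f]. *)
Lemma integral_against_bound (e : R) (f : M -> R) : continuous f ->
  (forall p, `|f p| <= e) -> `|J f| <= e * J (cst 1).
Proof.
move=> cf fe; have c1 : continuous (cst 1 : M -> R) by exact: cst_continuous.
have H r : `|r| = 1 -> r * J f <= e * J (cst 1).
  move=> r1; rewrite -subr_ge0 addrC -mulNr -integral_againstZ//.
  rewrite -integral_against_linear//; last first.
    by move=> x; apply: cvgM; [exact: cvg_cst|exact: c1].
  apply: integral_against_ge0 => p; rewrite /= mulr1 mulNr addrC subr_ge0.
  by rewrite (le_trans (ler_norm _))// normrM r1 mul1r.
rewrite ler_norml -{2}[J f]mul1r H ?normr1// andbT.
by rewrite lerNl -mulN1r H// normrN1.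
Qed.

Section parameters.
Context {k : nat} {W : set 'rV[R]_k}.
Hypothesis oW : open W.
Variable phi : 'rV[R]_k -> M -> R.
Hypothesis sphi : smooth_function_family X W phi.

Let cphi w : W w -> continuous (phi w).
Proof.
by move=> Ww; apply: smooth_function_continuous; exact: smooth_family_at sphi.
Qed.

Lemma integral_against_continuous w : W w ->
  {for w, continuous (fun w => J (phi w))}.
Proof.
move=> Ww; apply/(@cvgrPdist_lt _ _ _ _ (nbhs_filter w)) => e e0.
have J10 : 0 < J (cst 1) + 1.
  by rewrite ltr_wpDl// integral_against_ge0.
have close := compact_uniform_near (g := phi) cM
  (fun p _ => smooth_function_family_continuous sphi Ww) (divr_gt0 e0 J10).
have nW : \forall v \near w, W v by exact: open_nbhs_nbhs.
near=> v.
have Wv : W v by near: v.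
have Hv p : `|phi v p - phi w p| < e / (J (cst 1) + 1) by exact: (near close v).
rewrite -integral_againstB; [|exact: cphi..].
apply: le_lt_trans (_ : e / (J (cst 1) + 1) * J (cst 1) < _).
  apply: integral_against_bound => [p|p]; first by apply: cvgB; exact: cphi.
  by rewrite distrC ltW// Hv.
by rewrite mulrAC ltr_pdivrMr// ltr_pM2l// ltrDl.
Unshelve. all: by end_near. Qed.

(** By the mean value theorem the difference quotient at a point of [M] is the
    partial derivative at a nearby parameter; it is uniformly close to the one at
    [w] since [M] is compact. *)
Lemma is_derive_integral_against w (j : 'I_k) : W w ->
  is_derive w (delta_mx ord0 j) (fun w => J (phi w))
    (J (fun p => 'D_(delta_mx ord0 j) (phi ^~ p) w)).
Proof.
move=> Ww; set u := delta_mx ord0 j.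
pose dphi w p := 'D_u (phi ^~ p) w.
have sdphi : smooth_function_family X W dphi.
  exact: smooth_function_family_partial.
have cdphi v : W v -> continuous (dphi v).
  by move=> Wv; apply: smooth_function_continuous; exact: smooth_family_at sdphi.
suff H : (fun h : R => h^-1 *: (((fun w => J (phi w)) \o shift w) (h *: u) -
    J (phi w))) @ 0^' --> J (dphi w).
  by split; [apply/cvg_ex; exists (J (dphi w))|exact: cvg_lim].
apply/cvgrPdist_lt => e e0.
have J10 : 0 < J (cst 1) + 1.
  by rewrite ltr_wpDl// integral_against_ge0.
have close := compact_uniform_near (g := dphi) cM
  (fun p _ => smooth_function_family_continuous sdphi Ww) (divr_gt0 e0 J10).
have nW : \forall v \near w, W v by exact: open_nbhs_nbhs.
have : \forall v \near w, W v /\ forall p, [set: M] p ->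
    `|dphi v p - dphi w p| < e / (J (cst 1) + 1) by apply: filterI.
move=> /nbhs_ballP[d /= d0 Hd].
have u0 : 0 < `|u| + 1 by rewrite ltr_wpDl.
near=> h.
have h0 : h != 0 by near: h; exact: nbhs_dnbhs_neq.
have hd : `|h| < d / (`|u| + 1).
  by near: h; apply: dnbhs0_lt; rewrite divr_gt0.
have inball s : `|s| <= `|h| -> ball w d (s *: u + w).
  move=> sh; rewrite -ball_normE /ball_/= opprD addrCA subrr addr0 normrN normrZ.
  move: hd; rewrite ltr_pdivlMr// => hd; apply: le_lt_trans hd.
  by rewrite ler_pM// lerDl.
have Wh : W (h *: u + w) by have [] := Hd _ (inball h (lexx _)).
have E : (fun p => dphi w p - h^-1 * (phi (h *: u + w) p - phi w p)) =
  (fun p => - h^-1 * (phi (h *: u + w) p - phi w p) + dphi w p).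
  by apply/funext => p; rewrite mulNr addrC.
have cdiff : continuous (fun p => phi (h *: u + w) p - phi w p).
  by move=> p; apply: cvgB; exact: cphi.
have -> : J (dphi w) - h^-1 *: (((fun w => J (phi w)) \o shift w) (h *: u) -
    J (phi w)) = J (fun p => dphi w p - h^-1 * (phi (h *: u + w) p - phi w p)).
  rewrite E integral_against_linear//; last exact: cdphi.
  by rewrite integral_againstB; [rewrite mulNr addrC|exact: cphi..].
apply: le_lt_trans (_ : e / (J (cst 1) + 1) * J (cst 1) < _); last first.
  by rewrite mulrAC ltr_pdivrMr// ltr_pM2l// ltrDl.
apply: integral_against_bound => [|p].
  rewrite E => p; apply: cvgD; last exact: cdphi.
  by apply: cvgM; [exact: cvg_cst|exact: cdiff].
have [s sh|s sh ->] := @derive_MVT R _ (phi ^~ p) w u h.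
  apply: smooth_function_family_derivable sphi _ => //.
  by have [] := Hd _ (inball s sh).
rewrite mulKf// distrC ltW//.
by have [_] := Hd _ (inball s sh); apply.
Unshelve. all: by end_near. Qed.

End parameters.

Lemma smooth_on_integral_against {k} (W : set 'rV[R]_k) phi : open W ->
  smooth_function_family X W phi -> smooth_on W (fun w => J (phi w)).
Proof.
move=> oW sphi; apply: (@smooth_on_coind R _ _ (fun F => exists2 phi,
  smooth_function_family X W phi & F = fun w => J (phi w))) => //;
  last by exists phi.
move=> {sphi} _ [{}phi sphi ->]; split=> [w Ww|j].
  split; first exact: integral_against_continuous sphi _ Ww.
  by move=> j; have [] := is_derive_integral_against oW sphi j Ww.
exists (fun w => J (fun p => 'D_(delta_mx ord0 j) (phi ^~ p) w)).
  exists (fun w p => 'D_(delta_mx ord0 j) (phi ^~ p) w); last by [].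
  exact: smooth_function_family_partial.
by move=> w Ww; have [_ ->] := is_derive_integral_against oW sphi j Ww.
Qed.

End integral_against_density.

(** * Top forms as functions *)

Section forms.
Context {R : realType} {n : nat} {M : topologicalType}.
Variables (X : oriented_atlas R n M) (P : partition_of_unity X).
Variable lambda : top_form X.
Hypothesis lambda_dens : Dens lambda.

Local Notation J := (integral_against P lambda).

Lemma top_formDE (a b : top_form X) i p : (a + b) i p = a i p + b i p.
Proof. by []. Qed.

Lemma top_formBE (a b : top_form X) i p : (a - b) i p = a i p - b i p.
Proof. by []. Qed.

Lemma chart_at_dom p : chart_dom (chart_at X p) p.
Proof. by rewrite /chart_at; case: cid. Qed.

Lemma dens_gt0 (mu : top_form X) i p : Dens mu -> chart_dom i p -> 0 < mu i p.
Proof. by move=> [_]; exact. Qed.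

Lemma dens_chart_at_gt0 (mu : top_form X) p :
  Dens mu -> 0 < mu (chart_at X p) p.
Proof. by move=> mu_dens; apply: dens_gt0 => //; exact: chart_at_dom. Qed.

(** Both forms change by the same Jacobian, so their quotient can be computed in
    any chart. *)
Lemma rn_mul (a : top_form X) i p : is_top_form a -> chart_dom i p ->
  a i p = rn a lambda p * lambda i p.
Proof.
move=> [_ _ ta] ip; have [[_ _ tl] _] := lambda_dens.
rewrite /rn (ta i (chart_at X p))//; last exact: chart_at_dom.
rewrite [in RHS](tl i (chart_at X p))//; last exact: chart_at_dom.
by rewrite mulrA divfK// gt_eqF// dens_chart_at_gt0.
Qed.

Lemma rnK (a : top_form X) : is_top_form a -> fscale (rn a lambda) lambda = a.
Proof.
move=> ta; apply/funext => i; apply/funext => p; rewrite /fscale.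
have [ip|nip] := pselect (chart_dom i p); first by rewrite -rn_mul.
have [a0 _ _] := ta; have [[l0 _ _] _] := lambda_dens.
by rewrite a0// l0// mulr0.
Qed.

Lemma rn_fscale (f : M -> R) : rn (fscale f lambda) lambda = f.
Proof.
by apply/funext => p; rewrite /rn /fscale mulfK// gt_eqF// dens_chart_at_gt0.
Qed.

Lemma rnD (a b mu : top_form X) p : rn (a + b) mu p = rn a mu p + rn b mu p.
Proof. by rewrite /rn -mulrDl. Qed.

Lemma rnB (a b mu : top_form X) p : rn (a - b) mu p = rn a mu p - rn b mu p.
Proof. by rewrite /rn -mulrBl. Qed.

Lemma rn_cscale (r : R) (a mu : top_form X) p :
  rn (cscale r a) mu p = r * rn a mu p.
Proof. by rewrite /rn /cscale /fscale mulrA. Qed.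

Lemma rn_fscale_l (f : M -> R) (a mu : top_form X) p :
  rn (fscale f a) mu p = f p * rn a mu p.
Proof. by rewrite /rn /fscale mulrA. Qed.

Lemma rn_div (a mu : top_form X) p : rn a mu p = rn a lambda p / rn mu lambda p.
Proof.
rewrite /rn invf_div mulrA divfK// gt_eqF//; exact: dens_chart_at_gt0.
Qed.

Lemma smooth_rn (a : top_form X) :
  is_top_form a -> smooth_function X (rn a lambda).
Proof.
move=> ta i; have [_ sa _] := ta; have [[_ sl _] _] := lambda_dens.
have oi : open (chart_img (X := X) i) by exact: chart_img_open.
have l0 x : chart_img i x -> 0 < (lambda i \o @chart_inv _ _ _ X i) x.
  by move=> ix; apply: dens_gt0 => //; exact: chart_inv_dom.
apply: smooth_on_ext (smooth_onM oi (sa i) (smooth_on_powR (-1) oi l0 (sl i))) => //.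
move=> x ix; rewrite powR_inv1; last exact/ltW/l0.
rewrite /= (rn_mul ta); last exact: chart_inv_dom.
by rewrite mulfK// gt_eqF//; exact: l0.
Qed.

Lemma smooth_functionD f g : smooth_function X f -> smooth_function X g ->
  smooth_function X (fun p => f p + g p).
Proof. by move=> sf sg i; apply: smooth_onD => //; exact: chart_img_open. Qed.

Lemma smooth_functionM f g : smooth_function X f -> smooth_function X g ->
  smooth_function X (fun p => f p * g p).
Proof. by move=> sf sg i; apply: smooth_onM => //; exact: chart_img_open. Qed.

Lemma smooth_function_cst r : smooth_function X (cst r).
Proof. by move=> i; apply: smooth_on_cst; exact: chart_img_open. Qed.

Lemma smooth_function_powR f r : (forall p, 0 < f p) -> smooth_function X f ->
  smooth_function X (fun p => f p `^ r).
Proof.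
by move=> f0 sf i; apply: smooth_on_powR => //; exact: chart_img_open.
Qed.

Lemma is_top_form_fscale f (a : top_form X) :
  smooth_function X f -> is_top_form a -> is_top_form (fscale f a : top_form X).
Proof.
move=> sf [a0 sa ta]; split.
- by move=> i p ip; rewrite /fscale a0// mulr0.
- by move=> i; apply: smooth_onM (sf i) (sa i); exact: chart_img_open.
- by move=> i j p ip jp; rewrite /fscale (ta i j)// mulrA.
Qed.

Lemma is_top_form_cscale (r : R) (a : top_form X) :
  is_top_form a -> is_top_form (cscale r a : top_form X).
Proof. by apply: is_top_form_fscale; exact: smooth_function_cst. Qed.

Lemma is_top_formD (a b : top_form X) :
  is_top_form a -> is_top_form b -> is_top_form (a + b : top_form X).
Proof.
move=> [a0 sa ta] [b0 sb tb]; split.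
- by move=> i p ip; rewrite top_formDE a0// b0// addr0.
- by move=> i; apply: smooth_onD (sa i) (sb i); exact: chart_img_open.
- by move=> i j p ip jp; rewrite !top_formDE (ta i j)// (tb i j)// mulrDl.
Qed.

Lemma add_cscale0 (a b : top_form X) : a + cscale 0 b = a.
Proof.
apply/funext => i; apply/funext => p.
by rewrite top_formDE /cscale /fscale /= mul0r addr0.
Qed.

Lemma top_formB_cscale (a b : top_form X) : a - b = a + cscale (-1) b.
Proof.
apply/funext => i; apply/funext => p.
by rewrite top_formBE top_formDE /cscale /fscale /= mulN1r.
Qed.

Lemma is_top_formB (a b : top_form X) : is_top_form a -> is_top_form b ->
  is_top_form (a - b : top_form X).
Proof.
by move=> ta tb; rewrite top_formB_cscale; exact/is_top_formD/is_top_form_cscale.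
Qed.

Lemma top_form_eq (a b : top_form X) : is_top_form a -> is_top_form b ->
  rn a lambda = rn b lambda -> a = b.
Proof. by move=> ta tb E; rewrite -(rnK ta) -(rnK tb) E. Qed.

Lemma rn_gt0 (mu : top_form X) p : Dens mu -> 0 < rn mu lambda p.
Proof. by move=> mu_dens; rewrite divr_gt0// dens_chart_at_gt0. Qed.

Lemma DensP (mu : top_form X) :
  is_top_form mu -> (forall p, 0 < rn mu lambda p) -> Dens mu.
Proof.
by move=> tmu mu0; split=> // i p ip; rewrite (rn_mul tmu ip) mulr_gt0// dens_gt0.
Qed.

Lemma integral_formE (a : top_form X) :
  is_top_form a -> integral_form P a = J (rn a lambda).
Proof. by move=> ta; rewrite /integral_against rnK. Qed.

(** Through this equivalence all questions about families of forms become
    questions about families of functions. *)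
Lemma smooth_family_rn {k} (W : set 'rV[R]_k) (c : 'rV[R]_k -> top_form X) :
  open W ->
  (forall w, W w -> is_top_form (c w)) ->
  smooth_family W c <-> smooth_function_family X W (fun w => rn (c w) lambda).
Proof.
move=> oW tc; have [[_ sl _] _] := lambda_dens.
have oZ i : open [set z : 'rV[R]_(k + n) |
    W (lsubmx z) /\ chart_img (X := X) i (rsubmx z)].
  by apply: open_lsubmx_rsubmx => //; exact: chart_img_open.
have sl' i : smooth_on [set z : 'rV[R]_(k + n) |
    W (lsubmx z) /\ chart_img (X := X) i (rsubmx z)]
    (fun z => lambda i (@chart_inv _ _ _ X i (rsubmx z))).
  apply: (@smooth_on_comp_coordinate R _ _ rsubmx _ (chart_img i)
    (lambda i \o chart_inv i)) => //; first exact: coordinate_map_rsubmx.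
  by move=> z [].
have l0 i x : chart_img i x -> 0 < lambda i (@chart_inv _ _ _ X i x).
  by move=> ix; apply: dens_gt0 => //; exact: chart_inv_dom.
split=> sc i.
  apply: smooth_on_ext (smooth_onM (oZ i) (sc i)
    (smooth_on_powR (-1) (oZ i) _ (sl' i))) => //; last first.
    by move=> z [_ iz]; exact: l0.
  move=> z [Wz iz]; rewrite powR_inv1; last exact/ltW/l0.
  rewrite (rn_mul (tc _ Wz)); last exact: chart_inv_dom.
  by rewrite mulfK// gt_eqF//; exact: l0.
apply: smooth_on_ext (smooth_onM (oZ i) (sc i) (sl' i)) => //.
by move=> z [Wz iz]; rewrite -rn_mul; [|exact: tc|exact: chart_inv_dom].
Qed.

Hypothesis cM : compact [set: M].

Lemma TProbD (a b : top_form X) : TProb P a -> TProb P b -> TProb P (a + b).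
Proof.
move=> [ta ia] [tb ib]; have tab := is_top_formD ta tb; split=> //.
rewrite integral_formE//.
have -> : rn (a + b) lambda = fun p => rn a lambda p + rn b lambda p.
  by apply/funext => p; rewrite rnD.
rewrite integral_againstD//; try exact: smooth_function_continuous (smooth_rn _).
by rewrite -!integral_formE// ia ib addr0.
Qed.

Lemma TProb_cscale (r : R) (a : top_form X) : TProb P a -> TProb P (cscale r a).
Proof.
move=> [ta ia]; have tra := is_top_form_cscale r ta; split=> //.
rewrite integral_formE//.
have -> : rn (cscale r a) lambda = fun p => r * rn a lambda p.
  by apply/funext => p; rewrite rn_cscale.
rewrite integral_againstZ//; try exact: smooth_function_continuous (smooth_rn _).
by rewrite -integral_formE// ia mulr0.
Qed.

Lemma TProbB (a b : top_form X) : TProb P a -> TProb P b -> TProb P (a - b).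
Proof. by move=> Ta Tb; rewrite top_formB_cscale; apply/TProbD/TProb_cscale. Qed.

(** The family [c w + t v w], with the new parameter [t] as last coordinate. *)
Definition extend {k} (c v : 'rV[R]_k -> top_form X) (z : 'rV[R]_(k + 1)) :
    top_form X :=
  c (lsubmx z) + cscale (rsubmx z ord0 ord0) (v (lsubmx z)).

Definition extend_dom {k} (W : set 'rV[R]_k) (c v : 'rV[R]_k -> top_form X) :
    set 'rV[R]_(k + 1) :=
  [set z | W (lsubmx z) /\ forall p, 0 < rn (extend c v z) lambda p].

Definition line {k} (w : 'rV[R]_k) (t : R) : 'rV[R]_(k + 1) :=
  t *: delta_mx ord0 (rshift k ord0) + row_mx w 0.

Section extension.
Context {k : nat} {W : set 'rV[R]_k} {c v : 'rV[R]_k -> top_form X}.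
Hypothesis oW : open W.
Hypothesis Pc : forall w, W w -> Prob P (c w).
Hypothesis sc : smooth_family W c.
Hypothesis Tv : forall w, W w -> TProb P (v w).
Hypothesis sv : smooth_family W v.

Let tc w : W w -> is_top_form (c w).
Proof. by move=> /Pc[[]]. Qed.

Let tv w : W w -> is_top_form (v w).
Proof. by move=> /Tv[]. Qed.

Let oW' : open (@lsubmx R 1 k 1 @^-1` W).
Proof. by apply: open_comp => // x _; exact: continuous_lsubmx. Qed.

Let sextend : smooth_function_family X (@lsubmx R 1 k 1 @^-1` W)
  (fun z => rn (extend c v z) lambda).
Proof.
have srn (b : 'rV[R]_k -> top_form X) : (forall w, W w -> is_top_form (b w)) ->
   smooth_family W b -> smooth_function_family X (@lsubmx R 1 k 1 @^-1` W)
     (fun z => rn (b (lsubmx z)) lambda).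
  move=> tb sb; have sb' := (smooth_family_rn oW tb).1 sb.
  exact: (smooth_function_family_comp oW' coordinate_map_lsubmx
    (fun _ Wz => Wz) sb').
have st : smooth_function_family X (@lsubmx R 1 k 1 @^-1` W)
    (fun z _ => rsubmx z ord0 ord0).
  apply: smooth_function_family_scalar => //.
  have -> : (fun z : 'rV[R]_(k + 1) => rsubmx z ord0 ord0) =
      (fun z => z ord0 (rshift k ord0)) by apply/funext => z; rewrite mxE.
  exact: smooth_on_coord.
apply: smooth_function_family_ext (smooth_function_familyD oW' (srn c tc sc)
   (smooth_function_familyM oW' st (srn v tv sv))) => //.
by move=> z Wz; apply/funext => p; rewrite rnD rn_cscale.
Qed.

Lemma open_extend_dom : open (extend_dom W c v).
Proof. exact: open_family_gt0 sextend. Qed.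

Lemma extend_smooth : smooth_function_family X (extend_dom W c v)
  (fun z => rn (extend c v z) lambda).
Proof.
by move=> i; have := @sextend i; apply: smooth_on_sub => z [[Wz _] iz].
Qed.

Lemma extend_Prob z : extend_dom W c v z -> Prob P (extend c v z).
Proof.
move=> [Wz z0]; have tz : is_top_form (extend c v z).
  by apply: is_top_formD; [exact: tc|exact/is_top_form_cscale/tv].
split; first exact: DensP.
rewrite integral_formE//.
have -> : rn (extend c v z) lambda = fun p =>
    rsubmx z ord0 ord0 * rn (v (lsubmx z)) lambda p + rn (c (lsubmx z)) lambda p.
  by apply/funext => p; rewrite rnD rn_cscale addrC.
rewrite integral_against_linear//.
- rewrite -!integral_formE; [|exact: tc|exact: tv].
  by rewrite (Pc Wz).2 (Tv Wz).2 mulr0 add0r.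
- by apply: (smooth_function_continuous (X := X)); apply: smooth_rn; exact: tv.
- by apply: (smooth_function_continuous (X := X)); apply: smooth_rn; exact: tc.
Qed.

Lemma extend_smooth_family : smooth_family (extend_dom W c v) (extend c v).
Proof.
apply/(smooth_family_rn open_extend_dom); last exact: extend_smooth.
by move=> z /extend_Prob[[]].
Qed.

Lemma extend_line w t : extend c v (line w t) = c w + cscale t (v w).
Proof.
rewrite /extend /line lsubmx_delta_rshift rsubmx_delta_rshift row_mxKl row_mxKr.
by rewrite addr0 !mxE eqxx mulr1.
Qed.

Lemma extend_dom0 w : W w -> extend_dom W c v (row_mx w 0).
Proof.
move=> Ww; split; first by rewrite row_mxKl.
move=> p; rewrite /extend row_mxKl row_mxKr mxE rnD rn_cscale mul0r addr0.
by apply: rn_gt0; have [] := Pc Ww.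
Qed.

End extension.

End forms.

(** * Directional derivatives of vector fields *)

Section derivatives_of_vector_fields.
Context {R : realType} {n : nat} {M : topologicalType}.
Variables (X : oriented_atlas R n M) (P : partition_of_unity X).
Variable lambda : top_form X.
Hypothesis lambda_dens : Dens lambda.
Hypothesis cM : compact [set: M].

Local Notation J := (integral_against P lambda).

(** Stated on lines through [x] because a segment [mu + t a] becomes such a line in
    the parameter space of an extended family. *)
Lemma is_derive_family_line {k} (D : set 'rV[R]_k) phi x j p : open D -> D x ->
  smooth_function_family X D phi ->
  is_derive (0 : R) 1 (fun t : R => phi (t *: delta_mx ord0 j + x) p)
    ('D_(delta_mx ord0 j) (phi ^~ p) x).
Proof.
move=> oD Dx sphi; apply/(is_derive_line0 (phi ^~ p)).
by apply: derivableP; exact: smooth_function_family_derivable sphi Dx.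
Qed.

Lemma is_derive_integral_line {k} (D : set 'rV[R]_k) phi x j : open D -> D x ->
  smooth_function_family X D phi ->
  is_derive (0 : R) 1 (fun t : R => J (phi (t *: delta_mx ord0 j + x)))
    (J (fun p => 'D_(delta_mx ord0 j) (phi ^~ p) x)).
Proof.
move=> oD Dx sphi; apply/(is_derive_line0 (fun x => J (phi x))).
exact: (is_derive_integral_against P cM lambda_dens oD sphi j Dx).
Qed.

Lemma near_line {k} (D : set 'rV[R]_k) (u x : 'rV[R]_k) : open D -> D x ->
  \forall t \near (0 : R), D (t *: u + x).
Proof.
move=> oD Dx.
have c0 : {for (0 : R), continuous (fun t : R => t *: u + x)}.
  by apply: cvgD; [exact: scalel_continuous|exact: cvg_cst].
have := c0 D; apply; rewrite /= scale0r add0r; exact: open_nbhs_nbhs.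
Qed.

Lemma smooth_vector_field {k} (W : set 'rV[R]_k) c b : open W ->
  (forall w, W w -> Prob P (c w)) -> smooth_family W c -> vector_field P b ->
  smooth_function_family X W (fun w => rn (b (c w)) lambda).
Proof.
move=> oW Pc sc [Tb sb]; have := sb k W c oW Pc sc.
by rewrite (smooth_family_rn lambda_dens)// => w /Pc /Tb [].
Qed.

Section along_family.
Context {k : nat} {W : set 'rV[R]_k} {c : 'rV[R]_k -> top_form X}.
Context {a b : top_form X -> top_form X}.
Hypothesis oW : open W.
Hypothesis Pc : forall w, W w -> Prob P (c w).
Hypothesis sc : smooth_family W c.
Hypothesis Ta : forall w, W w -> TProb P (a (c w)).
Hypothesis sa : smooth_family W (a \o c).
Hypothesis vb : vector_field P b.

Local Notation ext := (extend c (a \o c)).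
Local Notation dom := (extend_dom lambda W c (a \o c)).

Let odom : open dom.
Proof. exact: (open_extend_dom lambda_dens cM oW Pc sc Ta sa). Qed.

Let sbeta : smooth_function_family X dom (fun z => rn (b (ext z)) lambda).
Proof.
apply: smooth_vector_field => //.
  by move=> z; exact: (extend_Prob lambda_dens cM Pc Ta).
exact: (extend_smooth_family lambda_dens cM oW Pc sc Ta sa).
Qed.

(** The function of the form [dirD a b (c w)], see [dirDE]: the partial derivative
    in the last parameter of [b] along the extended family. *)
Definition dirD_coef w p :=
  'D_(delta_mx ord0 (rshift k ord0)) (fun z => rn (b (ext z)) lambda p)
    (row_mx w (0 : 'rV[R]_1)).

Lemma is_derive_coef w i p : W w ->
  is_derive (0 : R) 1 (fun t => b (c w + cscale t (a (c w))) i p)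
    (fscale (dirD_coef w) lambda i p).
Proof.
move=> Ww; have Dw := extend_dom0 lambda_dens (v := a \o c) Pc Ww.
have tb t : dom (line w t) -> is_top_form (b (c w + cscale t (a (c w)))).
  move=> Dt; have -> : c w + cscale t (a (c w)) = ext (line w t).
    by rewrite extend_line.
  by have [] := vb.1 _ (extend_Prob lambda_dens cM Pc Ta Dt).
have nD := near_line (delta_mx ord0 (rshift k ord0)) odom Dw.
have [ip|nip] := pselect (chart_dom i p); last first.
  rewrite /fscale; have [[l0 _ _] _] := lambda_dens.
  rewrite l0// mulr0; apply: (@near_eq_is_derive _ _ _ (cst 0)).
  by apply: filterS nD => t /tb [b0 _ _]; rewrite b0.
have d1 := is_derive_family_line (rshift k ord0) p odom Dw sbeta.
apply: (@near_eq_is_derive _ _ _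
  (fun t => rn (b (ext (line w t))) lambda p * lambda i p)).
  by apply: filterS nD => t /tb tbt; rewrite extend_line -rn_mul.
by apply: is_derive_eq; rewrite scaler0 add0r [LHS]mulrC.
Qed.

Lemma dirDE w : W w -> dirD a b (c w) = fscale (dirD_coef w) lambda.
Proof.
move=> Ww; apply/funext => i; apply/funext => p.
by rewrite /dirD derive1E; have [_ ->] := is_derive_coef i p Ww.
Qed.

Lemma is_derive_dirD w i p : W w ->
  is_derive (0 : R) 1 (fun t => b (c w + cscale t (a (c w))) i p)
    (dirD a b (c w) i p).
Proof. by move=> Ww; rewrite dirDE//; exact: is_derive_coef. Qed.

Lemma smooth_dirD_coef : smooth_function_family X W dirD_coef.
Proof.
have cmap : coordinate_map (fun w : 'rV[R]_k => row_mx w (0 : 'rV[R]_1)).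
  split=> [x|j].
    apply: (@row_mx_continuous R _ k 1 id (fun=> 0) x); first exact: cvg_id.
    exact: cst_continuous.
  by left; exists (lshift 1 j) => h x; exact: row_mx_delta_lshift.
have Wdom w : W w -> dom (row_mx w (0 : 'rV[R]_1)).
  by move=> Ww; exact: (extend_dom0 lambda_dens (v := a \o c) Pc Ww).
exact: (smooth_function_family_comp oW cmap Wdom
  (smooth_function_family_partial odom (rshift k ord0) sbeta)).
Qed.

Lemma smooth_dirD : smooth_function_family X W
  (fun w => rn (dirD a b (c w)) lambda).
Proof.
apply: smooth_function_family_ext smooth_dirD_coef => // w Ww.
by rewrite dirDE// rn_fscale.
Qed.

(** The integral of [b] vanishes along the extended family, and its derivative is
    the integral of the derivative. *)
Lemma TProb_dirD w : W w -> TProb P (dirD a b (c w)).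
Proof.
move=> Ww; rewrite dirDE//.
have Dw := extend_dom0 lambda_dens (v := a \o c) Pc Ww.
split.
  apply: is_top_form_fscale lambda_dens.1.
  exact: smooth_family_at Ww smooth_dirD_coef.
have d1 := is_derive_integral_line (rshift k ord0) odom Dw sbeta.
have nD := near_line (delta_mx ord0 (rshift k ord0)) odom Dw.
have d2 : is_derive (0 : R) 1
    (fun t : R => J (rn (b (ext (t *: delta_mx ord0 (rshift k ord0) +
      row_mx w (0 : 'rV[R]_1)))) lambda)) 0.
  apply: (@near_eq_is_derive _ _ _ (cst 0)).
  apply: filterS nD => t Dt.
  have [tb ib] := vb.1 _ (extend_Prob lambda_dens cM Pc Ta Dt).
  by rewrite -integral_formE.
by have [_ E1] := d1; have [_ E2] := d2; rewrite -[RHS]E2 E1.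
Qed.

End along_family.

Lemma smooth_family_cst {k} (W : set 'rV[R]_k) (e : top_form X) :
  open W -> is_top_form e -> smooth_family W (fun=> e).
Proof.
move=> oW te; apply/(smooth_family_rn lambda_dens) => //.
by apply: smooth_function_family_cst => //; exact: smooth_rn.
Qed.

(** The segment [mu + t v] as a family: the extension of a family over the point
    [R^0]. *)
Lemma cst_families (mu v : top_form X) : Prob P mu -> TProb P v ->
  [/\ open (extend_dom lambda [set: 'rV[R]_0] (fun=> mu) (fun=> v)),
      smooth_family (extend_dom lambda [set: 'rV[R]_0] (fun=> mu) (fun=> v))
        (extend (fun=> mu) (fun=> v)) &
      forall z, extend_dom lambda [set: 'rV[R]_0] (fun=> mu) (fun=> v) z ->
        Prob P (extend (fun=> mu) (fun=> v) z)].
Proof.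
move=> Pmu Tv; have oT : open [set: 'rV[R]_0] by exact: openT.
have Pm (w : 'rV[R]_0) : [set: 'rV[R]_0] w -> Prob P mu by [].
have Tw (w : 'rV[R]_0) : [set: 'rV[R]_0] w -> TProb P v by [].
have sm := smooth_family_cst oT Pmu.1.1.
have sv := smooth_family_cst oT Tv.1.
split=> [||z].
- exact: (open_extend_dom lambda_dens cM oT Pm sm Tw sv).
- exact: (extend_smooth_family lambda_dens cM oT Pm sm Tw sv).
- exact: (extend_Prob lambda_dens cM Pm Tw).
Qed.

Section at_point.
Context {mu : top_form X} {b : top_form X -> top_form X}.
Hypothesis Pmu : Prob P mu.
Hypothesis vb : vector_field P b.

Lemma TProb_dirD_at a : TProb P (a mu) -> TProb P (dirD a b mu).
Proof.
move=> Ta; have sT (e : top_form X) : is_top_form e ->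
    smooth_family [set: 'rV[R]_0] (fun=> e) := smooth_family_cst openT.
exact: (@TProb_dirD 0 setT (fun=> mu) a b openT (fun _ _ => Pmu)
  (sT _ Pmu.1.1) (fun _ _ => Ta) (sT _ Ta.1) vb 0 I).
Qed.

Lemma is_derive_dirD_at a i p : TProb P (a mu) ->
  is_derive (0 : R) 1 (fun t => b (mu + cscale t (a mu)) i p) (dirD a b mu i p).
Proof.
move=> Ta; have sT (e : top_form X) : is_top_form e ->
    smooth_family [set: 'rV[R]_0] (fun=> e) := smooth_family_cst openT.
exact: (@is_derive_dirD 0 setT (fun=> mu) a b openT (fun _ _ => Pmu)
  (sT _ Pmu.1.1) (fun _ _ => Ta) (sT _ Ta.1) vb 0 i p I).
Qed.

Lemma is_derive_rn_dirD a p : TProb P (a mu) ->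
  is_derive (0 : R) 1 (fun t => rn (b (mu + cscale t (a mu))) lambda p)
    (rn (dirD a b mu) lambda p).
Proof.
move=> Ta; have H := is_derive_dirD_at (chart_at X p) p Ta.
by apply: is_derive_eq; rewrite scaler0 add0r [LHS]mulrC.
Qed.

(** The derivative of [b] at [mu] is linear in the direction.  Restricted to the
    two-parameter family [mu + s a mu + t a' mu], the three directional
    derivatives become derivatives of one smooth function on an open set of
    [R^2]. *)
Lemma dirD_linear F a a' : TProb P (a mu) -> TProb P (a' mu) ->
  dirD (vscale F a + a') b mu = cscale (F mu) (dirD a b mu) + dirD a' b mu.
Proof.
move=> Ta Ta'.
have TFa : TProb P ((vscale F a + a') mu).
  by apply: (TProbD lambda_dens cM) => //; exact: (TProb_cscale lambda_dens cM).
apply: (top_form_eq lambda_dens).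
- exact: (TProb_dirD_at TFa).1.
- apply: is_top_formD; last exact: (TProb_dirD_at Ta').1.
  by apply: is_top_form_cscale; exact: (TProb_dirD_at Ta).1.
apply/funext => p; rewrite rnD rn_cscale.
pose c1 := extend (fun _ : 'rV[R]_0 => mu) (fun=> a mu).
pose W1 := extend_dom lambda [set: 'rV[R]_0] (fun=> mu) (fun=> a mu).
have P0 (w : 'rV[R]_0) : [set: 'rV[R]_0] w -> Prob P mu by [].
have [oW1 sc1 Pc1] : [/\ open W1, smooth_family W1 c1 &
  forall w, W1 w -> Prob P (c1 w)] := cst_families Pmu Ta.
pose c2 := extend c1 (fun=> a' mu).
pose W2 := extend_dom lambda W1 c1 (fun=> a' mu).
have V1 (w : 'rV[R]_(0 + 1)) : W1 w -> TProb P (a' mu) by [].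
have sv : smooth_family W1 (fun=> a' mu) := smooth_family_cst oW1 Ta'.1.
have oW2 : open W2 := open_extend_dom lambda_dens cM oW1 Pc1 sc1 V1 sv.
have sc2 : smooth_family W2 c2 :=
  extend_smooth_family lambda_dens cM oW1 Pc1 sc1 V1 sv.
have Pc2 w : W2 w -> Prob P (c2 w) :=
  @extend_Prob _ _ _ _ _ _ lambda_dens cM _ _ _ _ Pc1 V1 w.
pose i1 : 'I_(0 + 1 + 1) := lshift 1 (rshift 0 ord0).
pose i2 : 'I_(0 + 1 + 1) := rshift (0 + 1) ord0.
have c2E z : c2 z = mu + cscale (z ord0 i1) (a mu) + cscale (z ord0 i2) (a' mu).
  by rewrite /c2 /c1 /extend !mxE.
pose x0 : 'rV[R]_(0 + 1 + 1) := 0.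
have Wx0 : W2 x0.
  have := extend_dom0 lambda_dens (v := fun=> a' mu) Pc1
    (extend_dom0 lambda_dens (v := fun=> a mu) P0 (w := 0) I).
  by rewrite !row_mx0.
pose f z := rn (b (c2 z)) lambda p.
have sf : smooth_on W2 f.
  have sb := smooth_vector_field oW2 Pc2 sc2 vb.
  exact: (smooth_family_point p oW2 sb).
pose u1 : 'rV[R]_(0 + 1 + 1) := delta_mx ord0 i1.
pose u2 : 'rV[R]_(0 + 1 + 1) := delta_mx ord0 i2.
have c2line r s t : c2 (t *: (r *: u1 + s *: u2) + x0) =
    mu + cscale t (cscale r (a mu) + cscale s (a' mu)).
  rewrite c2E !mxE !eq_shift !eqxx /=; apply/funext => i; apply/funext => q.
  by rewrite !top_formDE /cscale /fscale /= !top_formDE; ring.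
have dline r s e : TProb P (e mu) ->
    e mu = cscale r (a mu) + cscale s (a' mu) ->
    is_derive x0 (r *: u1 + s *: u2) f (rn (dirD e b mu) lambda p).
  move=> Te eE; apply/is_derive_line0.
  have -> : (fun h : R => f (h *: (r *: u1 + s *: u2) + x0)) =
    (fun t => rn (b (mu + cscale t (e mu))) lambda p).
    by apply/funext => t; rewrite /f c2line eE.
  exact: is_derive_rn_dirD.
have cE (r s : R) i q : (cscale r (a mu) + cscale s (a' mu)) i q =
    r * a mu i q + s * a' mu i q by [].
have d1 : is_derive x0 u1 f (rn (dirD a b mu) lambda p).
  have := dline 1 0 a Ta; rewrite scale1r scale0r addr0; apply.
  by apply/funext => i; apply/funext => q; rewrite cE mul1r mul0r addr0.
have d2 : is_derive x0 u2 f (rn (dirD a' b mu) lambda p).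
  have := dline 0 1 a' Ta'; rewrite scale1r scale0r add0r; apply.
  by apply/funext => i; apply/funext => q; rewrite cE mul1r mul0r add0r.
have d3 : is_derive x0 (F mu *: u1 + u2) f
    (rn (dirD (vscale F a + a') b mu) lambda p).
  have := dline (F mu) 1 _ TFa; rewrite scale1r; apply.
  by apply/funext => i; apply/funext => q; rewrite cE mul1r.
have nW2 : \forall z \near x0, W2 z by exact: open_nbhs_nbhs.
have dFu z : W2 z -> is_derive z (F mu *: u1) f (F mu * 'D_u1 f z).
  move=> Wz; apply: derive_scale_direction.
  by have [_ df] := smooth_on_partially_derivable sf Wz; exact: df.
have dsum : is_derive x0 (F mu *: u1 + u2) f
    ('D_(F mu *: u1) f x0 + 'D_u2 f x0).
  apply: derive_add_direction.
  - near=> z; have Wz : W2 z by near: z.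
    by have [] := dFu z Wz.
  - apply: (@near_eq_continuous _ _ (fun z => F mu * 'D_u1 f z)).
      near=> z; have Wz : W2 z by near: z.
      by have [_ ->] := dFu z Wz.
    apply: (@continuousM _ _ (cst (F mu))); first exact: cst_continuous.
    by have [] := smooth_on_partially_derivable (smooth_on_partial i1 sf) Wx0.
  - by have [] := d2.
have [_ <-] := d3; have [_ ->] := dsum; have [_ ->] := dFu _ Wx0.
by have [_ ->] := d1; have [_ ->] := d2.
Unshelve. all: by end_near. Qed.

End at_point.

End derivatives_of_vector_fields.

(** * The connection is affine and torsion-free *)

Section connection.
Context {R : realType} {n : nat} {M : topologicalType}.
Variables (X : oriented_atlas R n M) (P : partition_of_unity X).
Variable lambda : top_form X.
Hypothesis lambda_dens : Dens lambda.
Hypothesis cM : compact [set: M].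
Hypothesis M0 : [set: M] !=set0.
Variable alpha : R.

Local Notation J := (integral_against P lambda).
Local Notation rnl a := (rn a lambda).
Local Notation nablat := (nabla_tilde P alpha lambda).

Lemma continuous_rn (a : top_form X) : is_top_form a -> continuous (rnl a).
Proof.
by move=> ta; apply: (smooth_function_continuous (X := X)); exact: smooth_rn.
Qed.

Lemma Prob_top_form (mu : top_form X) : Prob P mu -> is_top_form mu.
Proof. by move=> [[]]. Qed.

Lemma Prob_rn_gt0 (mu : top_form X) p : Prob P mu -> 0 < rnl mu p.
Proof. by move=> [Dmu _]; exact: rn_gt0. Qed.

Lemma continuous_rn_powR (mu : top_form X) r : Prob P mu ->
  continuous (fun p => rnl mu p `^ r).
Proof.
move=> Pmu p; apply: continuous_powR_comp; first exact: Prob_rn_gt0.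
by apply: continuous_rn; exact: Prob_top_form.
Qed.

Lemma pairingE (mu a b : top_form X) : Prob P mu ->
  fisher_rao_pairing P mu a b =
  J (fun p => rnl a p * rnl mu p `^ (-1) * rnl b p).
Proof.
move=> Pmu; have [[m0 _ _] _] := Pmu.1; have [[l0 _ _] _] := lambda_dens.
congr (integral_form P _); apply/funext => i; apply/funext => p.
have [ip|nip] := pselect (chart_dom i p); last first.
  by rewrite /fscale m0// l0// !mulr0.
have mp := Prob_rn_gt0 p Pmu.
rewrite /fscale powR_inv1 ?ltW// (rn_mul lambda_dens (Prob_top_form Pmu) ip).
rewrite (rn_div lambda_dens a) (rn_div lambda_dens b).
by field; rewrite gt_eqF.
Qed.

Lemma powerE (mu : top_form X) :
  integral_form P (power_form alpha lambda mu) =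
  J (fun p => rnl mu p `^ (alpha + 1)).
Proof. by []. Qed.

Lemma power_gt0 (mu : top_form X) : Prob P mu ->
  0 < integral_form P (power_form alpha lambda mu).
Proof.
move=> Pmu; have [p0 _] := M0; rewrite powerE.
apply: (@integral_against_gt0 _ _ _ _ P cM _ lambda_dens _ p0).
- exact: continuous_rn_powR.
- by move=> p; exact: powR_ge0.
- by apply: powR_gt0; exact: Prob_rn_gt0.
Qed.

Lemma rn_nabla_tilde (a b : top_form X -> top_form X) mu p : Prob P mu ->
  rnl (nablat a b mu) p = rnl (dirD a b mu) p - (alpha + 1) / 2 *
   (rnl (a mu) p * rnl mu p `^ (-1) * rnl (b mu) p -
    fisher_rao_pairing P mu (a mu) (b mu) /
      integral_form P (power_form alpha lambda mu) * rnl mu p `^ (alpha + 1)).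
Proof.
move=> Pmu; rewrite /nabla_tilde rnB rn_cscale rnB rn_cscale rn_fscale_l.
rewrite (rn_div lambda_dens (a mu) mu) (rn_fscale lambda_dens) powR_inv1//.
exact/ltW/Prob_rn_gt0.
Qed.

Lemma is_top_form_nabla_tilde (a b : top_form X -> top_form X) mu : Prob P mu ->
  vector_field P a -> vector_field P b -> is_top_form (nablat a b mu).
Proof.
move=> Pmu va vb; have Ta := va.1 _ Pmu; have [tb _] := vb.1 _ Pmu.
apply: is_top_formB.
  by have [] := TProb_dirD_at lambda_dens cM Pmu vb Ta.
apply: is_top_form_cscale; apply: is_top_formB.
  apply: is_top_form_fscale tb.
  have -> : rn (a mu) mu = fun p => rnl (a mu) p * rnl mu p `^ (-1).
    apply/funext => p; rewrite (rn_div lambda_dens (a mu) mu) powR_inv1//.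
    exact/ltW/Prob_rn_gt0.
  apply: smooth_functionM; first exact: smooth_rn Ta.1.
  apply: smooth_function_powR; first by move=> p; exact: Prob_rn_gt0.
  by apply: smooth_rn => //; exact: Prob_top_form.
apply: is_top_form_cscale; apply: is_top_form_fscale lambda_dens.1.
apply: smooth_function_powR; first by move=> p; exact: Prob_rn_gt0.
by apply: smooth_rn => //; exact: Prob_top_form.
Qed.

(** The quotient [pairing / int power] is the coefficient of the power form that
    makes the integral vanish. *)
Lemma TProb_nabla_tilde (a b : top_form X -> top_form X) mu : Prob P mu ->
  vector_field P a -> vector_field P b -> TProb P (nablat a b mu).
Proof.
move=> Pmu va vb; have tn := is_top_form_nabla_tilde Pmu va vb; split=> //.
have [ta _] := va.1 _ Pmu; have [tb _] := vb.1 _ Pmu.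
have [td id] := TProb_dirD_at lambda_dens cM Pmu vb (va.1 _ Pmu).
rewrite (integral_formE P lambda_dens tn).
set q := fisher_rao_pairing P mu (a mu) (b mu) /
  integral_form P (power_form alpha lambda mu).
have -> : rnl (nablat a b mu) = fun p => - ((alpha + 1) / 2) *
    ((- q) * rnl mu p `^ (alpha + 1) +
      rnl (a mu) p * rnl mu p `^ (-1) * rnl (b mu) p) + rnl (dirD a b mu) p.
  by apply/funext => p; rewrite rn_nabla_tilde// -/q; ring.
have cp r : continuous (fun p => rnl mu p `^ r) := @continuous_rn_powR mu r Pmu.
have ca : continuous (rnl (a mu)) by exact: continuous_rn.
have cb : continuous (rnl (b mu)) by exact: continuous_rn.
have cab : continuous (fun p => rnl (a mu) p * rnl mu p `^ (-1) * rnl (b mu) p).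
  move=> p; apply: cvgM; last exact: cb.
  by apply: cvgM; [exact: ca|exact: cp].
rewrite integral_against_linear//; last 2 first.
- move=> p; apply: cvgD; last exact: cab.
  by apply: cvgM; [exact: cvg_cst|exact: cp].
- exact: continuous_rn.
rewrite integral_against_linear// -powerE -pairingE//.
rewrite -(integral_formE P lambda_dens td).
rewrite id addr0 !mulNr /q divfK ?addNr ?mulr0 ?oppr0//.
by rewrite gt_eqF// power_gt0.
Qed.

Lemma vector_field_nabla_tilde (a b : top_form X -> top_form X) :
  vector_field P a -> vector_field P b -> vector_field P (nablat a b).
Proof.
move=> va vb; split=> [mu Pmu|k W c oW Pc sc]; first exact: TProb_nabla_tilde.
have tn w : W w -> is_top_form (nablat a b (c w)).
  by move=> Ww; apply: is_top_form_nabla_tilde => //; exact: Pc.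
apply: (smooth_family_rn lambda_dens oW tn).2.
have sA := smooth_vector_field lambda_dens oW Pc sc va.
have sB := smooth_vector_field lambda_dens oW Pc sc vb.
have sm : smooth_function_family X W (fun w => rnl (c w)).
  by apply/(smooth_family_rn lambda_dens) => // w /Pc; exact: Prob_top_form.
have spow r : smooth_function_family X W (fun w p => rnl (c w) p `^ r).
  by apply: smooth_function_family_powR => // w p /Pc; exact: Prob_rn_gt0.
have sd := smooth_dirD lambda_dens cM oW Pc sc (fun w Ww => va.1 _ (Pc w Ww))
  (va.2 k W c oW Pc sc) vb.
have sAB : smooth_function_family X W
    (fun w p => rnl (a (c w)) p * rnl (c w) p `^ (-1) * rnl (b (c w)) p).
  exact: (smooth_function_familyM oW
    (smooth_function_familyM oW sA (spow (-1))) sB).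
have sJ phi :=
  @smooth_on_integral_against R n M X P cM lambda lambda_dens k W phi oW.
have sfp (x : R) : smooth_function_family X W (fun _ _ => x).
  by apply: smooth_function_family_scalar => //; exact: smooth_on_cst.
have sq : smooth_function_family X W (fun w _ =>
    J (fun p => rnl (a (c w)) p * rnl (c w) p `^ (-1) * rnl (b (c w)) p) *
    J (fun p => rnl (c w) p `^ (alpha + 1)) `^ (-1)).
  apply: smooth_function_family_scalar => //; apply: smooth_onM => //.
    exact: sJ sAB.
  apply: smooth_on_powR => //; last exact: (sJ _ (spow (alpha + 1))).
  by move=> w /Pc Pcw; rewrite -powerE; exact: power_gt0.
have H := smooth_function_familyD oW sd
  (smooth_function_familyM oW (sfp (- ((alpha + 1) / 2)))
    (smooth_function_familyD oW sAB
      (smooth_function_familyM oW (sfp (-1))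
        (smooth_function_familyM oW sq (spow (alpha + 1)))))).
apply: smooth_function_family_ext H => // w Ww; have Pcw := Pc w Ww.
have Q0 := power_gt0 Pcw; rewrite powerE in Q0.
apply/funext => p; rewrite rn_nabla_tilde// pairingE// powerE.
by rewrite (powR_inv1 (ltW Q0)); ring.
Qed.

End connection.

Section levi_civita_connection.
Context {R : realType} {n : nat} {M : topologicalType}.
Variables (X : oriented_atlas R n M) (P : partition_of_unity X).
Variable lambda : top_form X.
Hypothesis lambda_dens : Dens lambda.
Hypothesis cM : compact [set: M].
Hypothesis M0 : [set: M] !=set0.
Variable alpha : R.

Local Notation J := (integral_against P lambda).
Local Notation rnl a := (rn a lambda).
Local Notation nablat := (nabla_tilde P alpha lambda).

Lemma near_Prob (mu v : top_form X) : Prob P mu -> TProb P v ->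
  \forall t \near (0 : R), Prob P (mu + cscale t v).
Proof.
move=> Pmu Tv; have [oD _ PD] := cst_families lambda_dens cM Pmu Tv.
have Pm (w : 'rV[R]_0) : [set: 'rV[R]_0] w -> Prob P mu by [].
have D0 := extend_dom0 lambda_dens (v := fun=> v) Pm (w := 0) I.
have := near_line (delta_mx ord0 (rshift 0 ord0)) oD D0.
by apply: filterS => t /PD; rewrite extend_line.
Qed.

Lemma is_derive_dirD_scalar F (a : top_form X -> top_form X) mu :
  smooth_scalar P F -> Prob P mu -> TProb P (a mu) ->
  is_derive (0 : R) 1 (fun t => F (mu + cscale t (a mu))) (dirD_scalar a F mu).
Proof.
move=> sF Pmu Ta; have [oD sD PD] := cst_families lambda_dens cM Pmu Ta.
have Pm (w : 'rV[R]_0) : [set: 'rV[R]_0] w -> Prob P mu by [].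
have D0 := extend_dom0 lambda_dens (v := fun=> a mu) Pm (w := 0) I.
have sFD := sF _ _ _ oD PD sD.
have [_ dF] := smooth_on_partially_derivable sFD D0.
have /derivableP/is_derive_line0 := dF (rshift 0 ord0).
have -> : (fun h : R => (F \o extend (fun=> mu) (fun=> a mu))
    (h *: delta_mx ord0 (rshift 0 ord0) +
     row_mx (0 : 'rV[R]_0) (0 : 'rV[R]_1))) =
    (fun t => F (mu + cscale t (a mu))).
  by apply/funext => t /=; rewrite extend_line.
by rewrite /dirD_scalar derive1E => -[H _]; exact: derivableP.
Qed.

(** Differentiation under the integral sign along the segment [mu + t a mu]. *)
Lemma dirD_scalar_integral (Phi : top_form X -> M -> R) (D : M -> R)
    (a : top_form X -> top_form X) mu : Prob P mu -> TProb P (a mu) ->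
  (forall k (W : set 'rV[R]_k) c, open W -> (forall w, W w -> Prob P (c w)) ->
     smooth_family W c -> smooth_function_family X W (fun w => Phi (c w))) ->
  (forall p,
     is_derive (0 : R) 1 (fun t => Phi (mu + cscale t (a mu)) p) (D p)) ->
  dirD_scalar a (fun nu => J (Phi nu)) mu = J D.
Proof.
move=> Pmu Ta sPhi dPhi; have [oD sD PD] := cst_families lambda_dens cM Pmu Ta.
have Pm (w : 'rV[R]_0) : [set: 'rV[R]_0] w -> Prob P mu by [].
have D0 := extend_dom0 lambda_dens (v := fun=> a mu) Pm (w := 0) I.
have sPD := sPhi _ _ _ oD PD sD.
have [_ E] :=
  is_derive_integral_line P lambda_dens cM (rshift 0 ord0) oD D0 sPD.
have := E; have -> : (fun t : R => J (Phi (extend (fun=> mu) (fun=> a mu)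
    (t *: delta_mx ord0 (rshift 0 ord0) +
     row_mx (0 : 'rV[R]_0) (0 : 'rV[R]_1))))) =
    (fun t => J (Phi (mu + cscale t (a mu)))).
  by apply/funext => t /=; rewrite extend_line.
rewrite /dirD_scalar derive1E => ->; congr J; apply/funext => p.
have [_ <-] := is_derive_family_line (rshift 0 ord0) p oD D0 sPD.
have [_ <-] := dPhi p.
have -> : (fun t : R => Phi (extend (fun=> mu) (fun=> a mu)
    (t *: delta_mx ord0 (rshift 0 ord0) +
     row_mx (0 : 'rV[R]_0) (0 : 'rV[R]_1))) p) =
    (fun t => Phi (mu + cscale t (a mu)) p).
  by apply/funext => t; rewrite extend_line.
by [].
Qed.

Lemma pairing_linear (mu a a' b : top_form X) r : Prob P mu ->
  is_top_form a -> is_top_form a' -> is_top_form b ->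
  fisher_rao_pairing P mu (cscale r a + a') b =
  r * fisher_rao_pairing P mu a b + fisher_rao_pairing P mu a' b.
Proof.
move=> Pmu ta ta' tb; rewrite !(pairingE lambda_dens)//.
have cc (x : top_form X) : is_top_form x ->
    continuous (fun p => rnl x p * rnl mu p `^ (-1) * rnl b p).
  move=> tx; have cx : continuous (rnl x) by exact: continuous_rn.
  have cb : continuous (rnl b) by exact: continuous_rn.
  have cp : continuous (fun p => rnl mu p `^ (-1)).
    exact: (@continuous_rn_powR _ _ _ _ P _ lambda_dens mu (-1) Pmu).
  by move=> p; apply: cvgM; [apply: cvgM; [exact: cx|exact: cp]|exact: cb].
have c1 := cc a ta; have c2 := cc a' ta'.
rewrite -integral_against_linear//; congr J.
by apply/funext => p; rewrite rnD rn_cscale; ring.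
Qed.

Lemma pairing_sym (mu a b : top_form X) :
  fisher_rao_pairing P mu a b = fisher_rao_pairing P mu b a.
Proof.
congr (integral_form P _); apply/funext => i; apply/funext => p.
by rewrite /fscale [rn a mu p * _]mulrC.
Qed.

Lemma rn_mul_sym (mu a b : top_form X) p i : Prob P mu ->
  is_top_form a -> is_top_form b -> rn a mu p * b i p = rn b mu p * a i p.
Proof.
move=> Pmu ta tb; have [ip|nip] := pselect (chart_dom i p); last first.
  by case: ta => -> // _ _; case: tb => -> // _ _; rewrite !mulr0.
rewrite (rn_mul lambda_dens ta ip) (rn_mul lambda_dens tb ip).
by rewrite (rn_div lambda_dens a mu) (rn_div lambda_dens b mu); ring.
Qed.

Lemma nabla_tildeE (a b : top_form X -> top_form X) mu i p :
  nablat a b mu i p = dirD a b mu i p - (alpha + 1) / 2 *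
    (rn (a mu) mu p * b mu i p - fisher_rao_pairing P mu (a mu) (b mu) /
       integral_form P (power_form alpha lambda mu) *
       power_form alpha lambda mu i p).
Proof. by []. Qed.

Lemma dirD_ext (a a' b b' : top_form X -> top_form X) mu : Prob P mu ->
  TProb P (a mu) -> a mu = a' mu -> eq_on_Prob P b b' ->
  dirD a b mu = dirD a' b' mu.
Proof.
move=> Pmu Ta aa' bb'; apply/funext => i; apply/funext => p.
rewrite /dirD !derive1E -aa'; apply: near_eq_derive.
by apply: filterS (near_Prob Pmu Ta) => t /bb' ->.
Qed.

Lemma affine_connection_nabla_tilde : affine_connection P nablat.
Proof.
split.
- exact: vector_field_nabla_tilde.
- move=> a a' b b' va va' vb vb' aa' bb' mu Pmu.
  by rewrite /nabla_tilde (dirD_ext Pmu (va.1 _ Pmu) (aa' _ Pmu) bb') aa'// bb'.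
- move=> F a a' b sF va va' vb mu Pmu.
  have Ta := va.1 _ Pmu; have Ta' := va'.1 _ Pmu; have Tb := vb.1 _ Pmu.
  apply/funext => i; apply/funext => p.
  have E : (vscale F (nablat a b) + nablat a' b) mu i p =
    F mu * nablat a b mu i p + nablat a' b mu i p by [].
  have Ev : (vscale F a + a') mu = cscale (F mu) (a mu) + a' mu by [].
  rewrite E !nabla_tildeE (dirD_linear lambda_dens cM Pmu vb)//.
  rewrite Ev (pairing_linear _ Pmu Ta.1 Ta'.1 Tb.1) rnD rn_cscale top_formDE.
  have -> : cscale (F mu) (dirD a b mu) i p = F mu * dirD a b mu i p by [].
  by ring.
- move=> a b b' va vb vb' mu Pmu.
  have Ta := va.1 _ Pmu; have Tb := vb.1 _ Pmu; have Tb' := vb'.1 _ Pmu.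
  apply/funext => i; apply/funext => p.
  have E : (nablat a b + nablat a b') mu i p =
    nablat a b mu i p + nablat a b' mu i p by [].
  have Eb : (b + b') mu = b mu + b' mu by [].
  rewrite E !nabla_tildeE Eb.
  have -> : fisher_rao_pairing P mu (a mu) (b mu + b' mu) =
     fisher_rao_pairing P mu (a mu) (b mu) +
     fisher_rao_pairing P mu (a mu) (b' mu).
    have -> : b mu + b' mu = cscale 1 (b mu) + b' mu.
      apply/funext => j; apply/funext => q.
      by rewrite !top_formDE /cscale /fscale /= mul1r.
    rewrite ![fisher_rao_pairing P mu (a mu) _]pairing_sym.
    by rewrite (pairing_linear _ Pmu Tb.1 Tb'.1 Ta.1) mul1r.
  have -> : dirD a (b + b') mu i p = dirD a b mu i p + dirD a b' mu i p.
    rewrite [LHS]/dirD derive1E.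
    have d1 := is_derive_dirD_at lambda_dens cM Pmu vb i p Ta.
    have d2 := is_derive_dirD_at lambda_dens cM Pmu vb' i p Ta.
    by have [_ <-] := is_deriveD d1 d2.
  by rewrite top_formDE; ring.
- move=> F a b sF va vb mu Pmu.
  have Ta := va.1 _ Pmu; have Tb := vb.1 _ Pmu.
  apply/funext => i; apply/funext => p.
  have E : (vscale (dirD_scalar a F) b + vscale F (nablat a b)) mu i p =
    dirD_scalar a F mu * b mu i p + F mu * nablat a b mu i p by [].
  have Eb : vscale F b mu = cscale (F mu) (b mu) by [].
  rewrite E !nabla_tildeE Eb.
  have -> : fisher_rao_pairing P mu (a mu) (cscale (F mu) (b mu)) =
     F mu * fisher_rao_pairing P mu (a mu) (b mu).
    have -> : cscale (F mu) (b mu) = cscale (F mu - 1) (b mu) + b mu.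
      apply/funext => j; apply/funext => q.
      by rewrite !top_formDE /cscale /fscale /=; ring.
    rewrite ![fisher_rao_pairing P mu (a mu) _]pairing_sym.
    by rewrite (pairing_linear _ Pmu Tb.1 Tb.1 Ta.1); ring.
  have -> : dirD a (vscale F b) mu i p =
      F mu * dirD a b mu i p + dirD_scalar a F mu * b mu i p.
    rewrite [LHS]/dirD derive1E.
    have d1 := is_derive_dirD_at lambda_dens cM Pmu vb i p Ta.
    have d2 := is_derive_dirD_scalar sF Pmu Ta.
    have := is_deriveM d2 d1.
    have mu0 : mu + cscale 0 (a mu) = mu.
      exact: add_cscale0.
    by rewrite !mu0 => -[_ H]; rewrite [LHS]H; congr (_ + _); exact: mulrC.
  have -> : cscale (F mu) (b mu) i p = F mu * b mu i p by [].
  by ring.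
Qed.

Lemma torsion_free_nabla_tilde : torsion_free P nablat.
Proof.
move=> a b va vb mu Pmu.
have Ta := va.1 _ Pmu; have Tb := vb.1 _ Pmu.
apply/funext => i; apply/funext => p.
have -> : (nablat a b - nablat b a) mu i p =
  nablat a b mu i p - nablat b a mu i p by [].
have -> : (dirD a b - dirD b a) mu i p = dirD a b mu i p - dirD b a mu i p by [].
rewrite !nabla_tildeE (rn_mul_sym p i Pmu Ta.1 Tb.1).
by rewrite [fisher_rao_pairing P mu (b mu) _]pairing_sym; ring.
Qed.

End levi_civita_connection.

(** * Compatibility, uniqueness and comparison *)

Section metric.
Context {R : realType} {n : nat} {M : topologicalType}.
Variables (X : oriented_atlas R n M) (P : partition_of_unity X).
Variable lambda : top_form X.
Hypothesis lambda_dens : Dens lambda.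
Hypothesis cM : compact [set: M].
Hypothesis M0 : [set: M] !=set0.
Variable alpha : R.

Local Notation J := (integral_against P lambda).
Local Notation rnl a := (rn a lambda).
Local Notation nablat := (nabla_tilde P alpha lambda).
Local Notation G := (fisher_rao P alpha lambda).

Lemma fisher_rao_sym (mu a b : top_form X) : G mu a b = G mu b a.
Proof.
congr (integral_form P _); apply/funext => i; apply/funext => p.
by rewrite /fscale [X in X * _]mulrAC.
Qed.

Lemma continuous_fisher_rao_integrand (mu a b : top_form X) : Prob P mu ->
  is_top_form a -> is_top_form b ->
  continuous (fun p => rnl mu p `^ (- alpha - 1) * rnl a p * rnl b p).
Proof.
move=> Pmu ta tb.
have cx : continuous (rnl a) by exact: continuous_rn.
have cb : continuous (rnl b) by exact: continuous_rn.
have cp : continuous (fun p => rnl mu p `^ (- alpha - 1)).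
  exact: (@continuous_rn_powR _ _ _ _ P _ lambda_dens mu _ Pmu).
move=> p; apply: cvgM; last exact: cb.
apply: cvgM; last exact: cx.
exact: cp.
Qed.

Lemma fisher_raoB (mu a a' b : top_form X) : Prob P mu ->
  is_top_form a -> is_top_form a' -> is_top_form b ->
  G mu (a - a') b = G mu a b - G mu a' b.
Proof.
move=> Pmu ta ta' tb.
have c1 := continuous_fisher_rao_integrand Pmu ta tb.
have c2 := continuous_fisher_rao_integrand Pmu ta' tb.
apply: etrans (@integral_againstB _ _ _ _ P cM _ lambda_dens _ _ c1 c2).
congr J.
by apply/funext => p; rewrite rnB; ring.
Qed.

(** The integrand is a positive power times a square. *)
Lemma fisher_rao_eq0 (mu a : top_form X) : Prob P mu -> is_top_form a ->
  G mu a a = 0 -> a = 0.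
Proof.
move=> Pmu ta; have [a0|na0] := pselect (forall p, rnl a p = 0).
  move=> _; rewrite -(rnK lambda_dens ta); apply/funext => i; apply/funext => p.
  by rewrite /fscale a0 mul0r.
have [p ap] : exists p, rnl a p != 0.
  apply: contrapT => H; apply: na0 => p; apply/eqP.
  by apply: contra_notT H; exists p.
suff : 0 < G mu a a by move=> + G0; rewrite G0 ltxx.
have c1 := continuous_fisher_rao_integrand Pmu ta ta.
apply: (@integral_against_gt0 _ _ _ _ P cM _ lambda_dens _ p c1).
  by move=> q; rewrite -mulrA mulr_ge0 ?powR_ge0// -expr2 sqr_ge0.
rewrite -mulrA mulr_gt0 ?powR_gt0//; first exact: (Prob_rn_gt0 (P := P)).
by rewrite -expr2 lt_neqAle sqr_ge0 eq_sym sqrf_eq0 ap.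
Qed.

(** With [s = - alpha - 1], the derivative [D] of the integrand differs from the sum
    of the integrands of the two right-hand terms by a combination of the
    functions of [b mu] and [c mu], and both have integral zero. *)
Lemma metric_compatible_nabla_tilde : metric_compatible P G nablat.
Proof.
move=> a b c va vb vc mu Pmu.
have Ta := va.1 _ Pmu; have Tb := vb.1 _ Pmu; have Tc := vc.1 _ Pmu.
have tm := Prob_top_form Pmu.
have Tnb := TProb_nabla_tilde lambda_dens cM M0 alpha Pmu va vb.
have Tnc := TProb_nabla_tilde lambda_dens cM M0 alpha Pmu va vc.
pose s := - alpha - 1.
pose Phi (nu : top_form X) p := rnl nu p `^ s * rnl (b nu) p * rnl (c nu) p.
have mu0 : mu + cscale 0 (a mu) = mu.
  exact: add_cscale0.
have sPhi k (W : set 'rV[R]_k) (d : 'rV[R]_k -> top_form X) : open W ->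
    (forall w, W w -> Prob P (d w)) -> smooth_family W d ->
    smooth_function_family X W (fun w => Phi (d w)).
  move=> oW Pd sd; have sB := smooth_vector_field lambda_dens oW Pd sd vb.
  have sC := smooth_vector_field lambda_dens oW Pd sd vc.
  have sm : smooth_function_family X W (fun w => rnl (d w)).
    have td w : W w -> is_top_form (d w) by move=> /Pd; exact: Prob_top_form.
    exact: (smooth_family_rn lambda_dens oW td).1.
  have m0 w p : W w -> 0 < rnl (d w) p by move=> /Pd; exact: Prob_rn_gt0.
  exact: (smooth_function_familyM oW (smooth_function_familyM oW
    (smooth_function_family_powR oW s m0 sm) sB) sC).
pose D p :=
  s * rnl mu p `^ (s - 1) * rnl (a mu) p * rnl (b mu) p * rnl (c mu) p +
  rnl mu p `^ s * rnl (dirD a b mu) p * rnl (c mu) p +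
  rnl mu p `^ s * rnl (b mu) p * rnl (dirD a c mu) p.
have dPhi p : is_derive (0 : R) 1 (fun t => Phi (mu + cscale t (a mu)) p) (D p).
  have dB := is_derive_rn_dirD lambda_dens cM Pmu vb p Ta.
  have dC := is_derive_rn_dirD lambda_dens cM Pmu vc p Ta.
  have dm : is_derive (0 : R) 1 (fun t => rnl (mu + cscale t (a mu)) p)
      (rnl (a mu) p).
    have -> : (fun t => rnl (mu + cscale t (a mu)) p) =
      (fun t => rnl mu p + t * rnl (a mu) p).
      by apply/funext => t; rewrite rnD rn_cscale.
    by apply: is_derive_eq; rewrite add0r mul1r scaler0 add0r [LHS]mulr1.
  have m0 : 0 < (fun t => rnl (mu + cscale t (a mu)) p) 0.
    by rewrite /= mu0; exact: (Prob_rn_gt0 (P := P)).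
  have dp := @is_derive_powR R _ (fun t => rnl (mu + cscale t (a mu)) p) s
    (rnl (a mu) p) 0 1 m0 dm.
  have [H1 H2] := is_deriveM (is_deriveM dp dB) dC.
  split; first exact: H1.
  rewrite [LHS]H2 !mu0.
  rewrite [X in X *: rnl (dirD a c mu) p](_ : _ = rnl mu p `^ s * rnl (b mu) p).
    by rewrite /D /GRing.scale /=; ring.
  transitivity (rnl (mu + cscale 0 (a mu)) p `^ s *
    rnl (b (mu + cscale 0 (a mu))) p) => //.
  by rewrite mu0.
have -> : dirD_scalar a (fun nu => G nu (b nu) (c nu)) mu = J D.
  exact: (dirD_scalar_integral lambda_dens cM Pmu Ta sPhi dPhi).
set k := (alpha + 1) / 2.
set qb := fisher_rao_pairing P mu (a mu) (b mu) /
      integral_form P (power_form alpha lambda mu).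
set qc := fisher_rao_pairing P mu (a mu) (c mu) /
      integral_form P (power_form alpha lambda mu).
pose FB p := rnl mu p `^ s * rnl (nablat a b mu) p * rnl (c mu) p.
pose FC p := rnl mu p `^ s * rnl (b mu) p * rnl (nablat a c mu) p.
have -> : D = fun p => - (k * qb) * rnl (c mu) p +
    (- (k * qc) * rnl (b mu) p + (FB p + FC p)).
  apply/funext => p; have mp := Prob_rn_gt0 lambda_dens p Pmu.
  rewrite /D /FB /FC !(rn_nabla_tilde lambda_dens)// -/qb -/qc -/k.
  have E1 : rnl mu p `^ s * rnl mu p `^ (alpha + 1) = 1.
    have sE : s + (alpha + 1) = 0 by rewrite /s; ring.
    rewrite -powRD; last by rewrite (gt_eqF mp) implybT.
    by rewrite sE powRr0.
  have E2 : rnl mu p `^ (s - 1) = rnl mu p `^ s * rnl mu p `^ (-1).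
    by rewrite -powRD// (gt_eqF mp) implybT.
  rewrite E2; apply/eqP; rewrite -subr_eq0; apply/eqP.
  set y := _ `^ s; set z := _ `^ (alpha + 1) in E1 *.
  set w := _ `^ (-1).
  transitivity (k * (qb * rnl (c mu) p + qc * rnl (b mu) p) * (1 - y * z)).
    by rewrite /k /s; field.
  by rewrite E1 subrr mulr0.
have cB : continuous (rnl (b mu)) by apply: continuous_rn => //; exact: Tb.1.
have cC : continuous (rnl (c mu)) by apply: continuous_rn => //; exact: Tc.1.
have cFB := continuous_fisher_rao_integrand Pmu Tnb.1 Tc.1.
have cFC := continuous_fisher_rao_integrand Pmu Tb.1 Tnc.1.
have cF : continuous (fun p => FB p + FC p).
  by move=> p; apply: cvgD; [exact: cFB|exact: cFC].
have cF2 : continuous (fun p => - (k * qc) * rnl (b mu) p + (FB p + FC p)).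
  by move=> p; apply: cvgD; [apply: cvgM; [exact: cvg_cst|exact: cB]|exact: cF].
rewrite (integral_against_linear P cM lambda_dens _ cC cF2).
rewrite (integral_against_linear P cM lambda_dens _ cB cF).
rewrite (integral_againstD P cM lambda_dens cFB cFC).
rewrite -(integral_formE P lambda_dens Tb.1) -(integral_formE P lambda_dens Tc.1).
by rewrite Tb.2 Tc.2 !mulr0 !add0r.
Qed.

Lemma levi_civita_nabla_tilde : levi_civita P G nablat.
Proof.
split; first exact: affine_connection_nabla_tilde.
- exact: torsion_free_nabla_tilde.
- exact: metric_compatible_nabla_tilde.
Qed.

Lemma vector_field_cst (v : top_form X) : TProb P v -> vector_field P (fun=> v).
Proof.
move=> Tv; split=> [mu _|k W c oW Pc sc]; first exact: Tv.
exact: (smooth_family_cst lambda_dens oW Tv.1).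
Qed.

(** [T x y z = G (S x y) z], with [S] the difference of the connections, is
    symmetric in [x], [y] and skew in [y], [z], hence zero. The constant vector
    field [S a b mu] then tests [S a b mu] against itself. *)
Lemma levi_civita_unique nabla nabla' (a b : top_form X -> top_form X) :
  levi_civita P G nabla -> levi_civita P G nabla' ->
  vector_field P a -> vector_field P b -> eq_on_Prob P (nabla a b) (nabla' a b).
Proof.
move=> [an tn mn] [an' tn' mn'] va vb mu Pmu.
pose T (x y z : top_form X -> top_form X) :=
  G mu (nabla x y mu - nabla' x y mu) (z mu).
have vn x y : vector_field P x -> vector_field P y ->
    vector_field P (nabla x y).
  exact: conn_vector_field.
have vn' x y : vector_field P x -> vector_field P y ->
    vector_field P (nabla' x y).
  exact: conn_vector_field.
have top x : vector_field P x -> is_top_form (x mu).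
  by move=> vx; have [] := vx.1 _ Pmu.
have Tsym x y z : vector_field P x -> vector_field P y -> T x y z = T y x z.
  move=> vx vy; congr (G mu _ _).
  have := tn x y vx vy mu Pmu; rewrite -(tn' x y vx vy mu Pmu) => H.
  apply/funext => i; apply/funext => p.
  have Hp : nabla x y mu i p - nabla y x mu i p =
    nabla' x y mu i p - nabla' y x mu i p by exact: (congr1 (fun f => f i p) H).
  by rewrite !top_formBE; lra.
have Tskew x y z : vector_field P x -> vector_field P y -> vector_field P z ->
    T x y z = - T x z y.
  move=> vx vy vz; have H := mn x y z vx vy vz mu Pmu.
  rewrite (mn' x y z vx vy vz mu Pmu) in H.
  have tn_ u (vu : vector_field P u) := top _ (vn x u vx vu).
  have tn_' u (vu : vector_field P u) := top _ (vn' x u vx vu).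
  rewrite /T (fisher_raoB Pmu (tn_ y vy) (tn_' y vy) (top _ vz)).
  rewrite (fisher_raoB Pmu (tn_ z vz) (tn_' z vz) (top _ vy)).
  rewrite (fisher_rao_sym mu (y mu)) (fisher_rao_sym mu (y mu)) in H.
  lra.
have T0 x y z : vector_field P x -> vector_field P y -> vector_field P z ->
    T x y z = 0.
  move=> vx vy vz.
  (* Exchanging the last two and the first two arguments alternately six times
     returns to [T x y z], with three changes of sign. *)
  have H1 := Tskew x y z vx vy vz; have H2 := Tsym x z y vx vz.
  have H3 := Tskew z x y vz vx vy; have H4 := Tsym z y x vz vy.
  have H5 := Tskew y z x vy vz vx; have H6 := Tsym y x z vy vx.
  by lra.
pose S := nabla a b mu - nabla' a b mu.
have TS : TProb P S.
  apply: (TProbB lambda_dens cM); first exact: (vn _ _ va vb).1.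
  exact: (vn' _ _ va vb).1.
have S0 := T0 a b (fun=> S) va vb (vector_field_cst TS).
have : S = 0 by apply: (fisher_rao_eq0 Pmu TS.1).
by move/eqP; rewrite subr_eq0 => /eqP.
Qed.

(** If all functions of the partition of unity are constant, a nonzero one has
    support [M], so a single chart covers [M] and its first coordinate is smooth
    on [M]; it is not constant as the image of the chart is open. *)
Lemma exists_nonconstant_smooth_function : (1 <= n)%N ->
  exists f p q, [/\ smooth_function X f & f p != f q].
Proof.
move=> n1; have [p0 _] := M0.
have [k pk] : exists k : 'I_(pou_size P), pou_fun k p0 != 0.
  apply: contrapT => npk; have := pou_sum P p0.
  rewrite big1; first by move/eqP; rewrite eq_sym oner_eq0.
  by move=> k _; apply/eqP; apply: contra_notT npk => pk; exists k.
have [[q nq]|nq] := pselect (exists q, pou_fun k q != pou_fun k p0).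
  by exists (pou_fun k), q, p0; split=> //; exact: pou_smooth.
set j := pou_chart k.
have domj p : chart_dom j p.
  apply: pou_support; apply: subset_closure => /=.
  have -> // : pou_fun k p = pou_fun k p0.
  by apply/eqP; apply: contra_notT nq => H; exists p.
pose c := Ordinal n1.
pose f p := @chart _ _ _ X j p ord0 c.
have sf : smooth_function X f.
  move=> i; have := @transition_smooth _ _ _ X i j c; apply: smooth_on_sub.
  by move=> _ [p ip <-]; exists p.
have oj : open (chart_img (X := X) j) by exact: chart_img_open.
have xj : chart_img j (@chart _ _ _ X j p0) by exists p0 => //; exact: domj.
have /(@nbhs_ballP R)[e /= e0 He] := near_line (delta_mx ord0 c) oj xj.
have [q _ qE] : chart_img (X := X) j ((e / 2) *: delta_mx ord0 c + chart j p0).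
  by apply: He; rewrite -ball_normE /ball_/= sub0r normrN gtr0_norm; lra.
exists f, q, p0; split=> //; rewrite /f qE !mxE !eqxx mulr1.
by rewrite -subr_eq0 addrK; apply/eqP; lra.
Qed.

Lemma nabla_tilde_eq_amari_cencov : alpha = 0 \/ alpha = -1 ->
  forall a b mu, Prob P mu -> nablat a b mu = amari_cencov P alpha a b mu.
Proof.
move=> [->|->] a b mu Pmu; last first.
  have k1 : (-1 + 1 : R) / 2 = 0 by rewrite addNr mul0r.
  have k2 : (1 + -1 : R) / 2 = 0 by rewrite subrr mul0r.
  rewrite /nabla_tilde /amari_cencov k1 k2.
  congr (_ - _); apply/funext => i; apply/funext => p.
  by rewrite /cscale /fscale /= !mul0r.
have E : power_form 0 lambda mu = mu.
  rewrite -[RHS](rnK lambda_dens (Prob_top_form Pmu)).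
  apply/funext => i; apply/funext => p; rewrite /power_form /fscale add0r powRr1//.
  exact/ltW/(Prob_rn_gt0 (P := P)).
by rewrite /nabla_tilde /amari_cencov E Pmu.2 invr1 mulr1 [0 + 1]addrC.
Qed.

(** The test density is a multiple of [u = (f - f p)^2 + 1], which is positive and
    takes different values at [p] and [q]; the test vector is [u] minus its
    mean. *)
Lemma nabla_tilde_eq_amari_cencov_alpha : (1 <= n)%N ->
  (forall a b, vector_field P a -> vector_field P b ->
     eq_on_Prob P (nablat a b) (amari_cencov P alpha a b)) ->
  alpha = 0 \/ alpha = -1.
Proof.
move=> n1 H; apply: contrapT => /not_orP[/eqP a0 /eqP a1].
have [f [p [q [sf fpq]]]] := exists_nonconstant_smooth_function n1.
pose u x := (f x - f p) ^+ 2 + 1.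
have su : smooth_function X u.
  have sfp : smooth_function X (fun x => f x + - f p).
    exact: smooth_functionD sf (smooth_function_cst _).
  apply: smooth_functionD; last exact: smooth_function_cst.
  exact: smooth_functionM.
have cu : continuous u by exact: smooth_function_continuous su.
have u0 x : 0 < u x by rewrite /u ltr_wpDl// sqr_ge0.
have Ju : 0 < J u.
  apply: (@integral_against_gt0 _ _ _ _ P cM _ lambda_dens _ p cu) => // x.
  exact: ltW.
have upq : u p != u q.
  rewrite /u subrr expr0n add0r eq_sym -subr_eq0 addrK sqrf_eq0 subr_eq0 eq_sym.
  exact: fpq.
have c1 : continuous (cst 1 : M -> R) by exact: cst_continuous.
have J1 : 0 < J (cst 1).
  by apply: (@integral_against_gt0 _ _ _ _ P cM _ lambda_dens _ p c1) => //= x.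
pose mu := fscale (fun x => (J u)^-1 * u x) lambda : top_form X.
have rmu : rnl mu = fun x => (J u)^-1 * u x by exact: rn_fscale.
have tmu : is_top_form mu.
  apply: is_top_form_fscale lambda_dens.1.
  exact: smooth_functionM (smooth_function_cst _) su.
have Pmu : Prob P mu.
  split.
    by apply: (DensP lambda_dens) => // x; rewrite rmu mulr_gt0 ?invr_gt0.
  rewrite (integral_formE P lambda_dens tmu) rmu integral_againstZ// mulVf//.
  by rewrite gt_eqF.
pose v := fscale (fun x => u x + - (J u / J (cst 1))) lambda : top_form X.
have rv : rnl v = fun x => u x + - (J u / J (cst 1)) by exact: rn_fscale.
have tv : is_top_form v.
  apply: is_top_form_fscale lambda_dens.1.
  exact: smooth_functionD su (smooth_function_cst _).
have Tv : TProb P v.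
  split=> //; rewrite (integral_formE P lambda_dens tv) rv.
  have -> : (fun x => u x + - (J u / J (cst 1))) =
    fun x => - (J u / J (cst 1)) * cst 1 x + u x.
    by apply/funext => x; rewrite /= mulr1 addrC.
  by rewrite integral_against_linear// mulNr divfK ?addNr// gt_eqF.
have vv : vector_field P (fun=> v) by exact: vector_field_cst.
set pr := fisher_rao_pairing P mu v v.
have pr0 : 0 < pr.
  have [x vx] : exists x, rnl v x != 0.
    apply: contrapT => nx; move/eqP : upq; apply.
    have vx x : u x = J u / J (cst 1).
      have : rnl v x = 0 by apply/eqP; apply: contra_notT nx; exists x.
      by rewrite rv => /eqP; rewrite subr_eq0 => /eqP.
    by rewrite !vx.
  have cv : continuous (rnl v) by exact: continuous_rn.
  have cp : continuous (fun p => rnl mu p `^ (-1)).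
    exact: (@continuous_rn_powR _ _ _ _ P _ lambda_dens mu _ Pmu).
  have cvv : continuous (fun p => rnl v p * rnl mu p `^ (-1) * rnl v p).
    by move=> y; apply: cvgM; [apply: cvgM; [exact: cv|exact: cp]|exact: cv].
  rewrite /pr (pairingE lambda_dens)//.
  apply: (@integral_against_gt0 _ _ _ _ P cM _ lambda_dens _ x cvv) => [y|].
    by rewrite mulrAC mulr_ge0 ?powR_ge0// -expr2 sqr_ge0.
  rewrite mulrAC mulr_gt0 ?powR_gt0//; last exact: (Prob_rn_gt0 (P := P)).
  by rewrite -expr2 lt_neqAle sqr_ge0 eq_sym sqrf_eq0 vx.
set Q := integral_form P (power_form alpha lambda mu).
have Q0 : 0 < Q by exact: power_gt0.
have key x : rnl mu x `^ alpha = Q.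
  have mx := Prob_rn_gt0 lambda_dens x Pmu.
  have k0 : alpha + 1 != 0 by rewrite addr_eq0.
  have := congr1 (fun w => rnl w x) (H _ _ vv vv mu Pmu).
  rewrite /= (rn_nabla_tilde lambda_dens)// -/pr -/Q /amari_cencov.
  rewrite rnB rn_cscale rnB rn_cscale rn_fscale_l -/pr (rn_div lambda_dens v mu).
  rewrite powR_inv1 ?ltW// [1 + alpha]addrC => E.
  have {}E : pr / Q * rnl mu x `^ (alpha + 1) = pr * rnl mu x.
    have k20 : (alpha + 1) / 2 != 0 by rewrite mulf_neq0// invr_eq0 pnatr_eq0.
    by apply: (mulfI k20); lra.
  have E3 : rnl mu x `^ (alpha + 1) = rnl mu x `^ alpha * rnl mu x.
    by rewrite powRD ?powRr1 ?ltW// (gt_eqF mx) implybT.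
  move: E; rewrite E3 mulrA => /(mulIf (lt0r_neq0 mx)) E4.
  apply: (mulfI (lt0r_neq0 pr0)).
  by have := congr1 ( *%R^~ Q) E4; rewrite mulrAC divfK// gt_eqF.
have muE x : rnl mu x = Q `^ alpha^-1.
  rewrite -(key x) -powRrM mulfV// powRr1// ltW//.
  exact: (Prob_rn_gt0 (P := P)).
move/eqP : upq; apply.
have Jn : (J u)^-1 != 0 by rewrite invr_eq0 gt_eqF.
apply: (mulfI Jn); have := muE p; have := muE q; rewrite rmu => -> ->.
by [].
Qed.

End metric.

Theorem lemma4p1 (R : realType) (n : nat) (M : topologicalType)
  (X : oriented_atlas R n M) (P : partition_of_unity X)
  (n_ge1 : (1 <= n)%N)
  (M_nonempty : [set: M] !=set0)
  (M_compact : compact [set: M])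
  (M_hausdorff : hausdorff_space M)
  (alpha : R) (lambda : top_form X) (lambda_dens : Dens lambda) :
  (* the connection nabla_tilde is the Levi-Civita connection of G^alpha *)
  (levi_civita P (fisher_rao P alpha lambda) (nabla_tilde P alpha lambda) /\
   forall nabla : (top_form X -> top_form X) -> (top_form X -> top_form X) -> top_form X -> top_form X,
     levi_civita P (fisher_rao P alpha lambda) nabla ->
     forall a b : top_form X -> top_form X, vector_field P a -> vector_field P b ->
       eq_on_Prob P (nabla a b) (nabla_tilde P alpha lambda a b)) /\
  ((forall a b : top_form X -> top_form X, vector_field P a -> vector_field P b ->
      eq_on_Prob P (nabla_tilde P alpha lambda a b) (amari_cencov P alpha a b))
   <-> alpha = 0 \/ alpha = -1).
Proof.
have LC := levi_civita_nabla_tilde P lambda_dens M_compact M_nonempty alpha.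
split; [split=> // nabla LCn a b va vb|split].
- exact: levi_civita_unique LCn LC va vb.
- exact: nabla_tilde_eq_amari_cencov_alpha.
- by move=> H a b va vb mu Pmu; exact: nabla_tilde_eq_amari_cencov.
Qed.
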